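(* Let $G$ be an oriented graph with $n$ vertices and $m$ edges. 1. If $G$ is 3-edge-connected, then $G$ has at least $2^{(m-n)/3}$ nowhere-zero $\mathbb{Z}_6$-flows. 2. If $G$ is 4-edge-connected, then $G$ has at least $2^{n/3}$ nowhere-zero $\mathbb{Z}_2\times\mathbb{Z}_2$-flows.
   Context: Graphs are finite and may have loops and parallel edges. A graph is $k$-edge-connected if it has at least two vertices and remains connected after deleting any set of fewer than $k$ edges (an oriented graph is $k$-edge-connected if its underlying undirected graph is). For an oriented graph $G=(V,E)$ and $v\in V$, $\delta^+(v)$ is the set of edges with initial vertex $v$ and $\delta^-(v)$ the set of edges with terminal vertex $v$ (a loop at $v$ belongs to both). For an additive abelian group $\Gamma$, a $\Gamma$-flow is a function $\phi:E\to\Gamma$ with $\sum_{e\in\delta^+(v)}\phi(e)=\sum_{e\in\delta^-(v)}\phi(e)$ for every $v\in V$. It is nowhere-zero if $\phi(e)\neq 0$ for every $e\in E$. *)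

(* Defs.v *)
From HB Require Import structures.
From mathcomp Require Import all_boot all_order all_algebra.

Set Implicit Arguments.
Unset Strict Implicit.
Unset Printing Implicit Defensive.

Import GRing.Theory.
Local Open Scope ring_scope.

(* Derives the finZmodType structure on products of finZmodTypes, which the
   library does not declare, from the existing finType and zmodType ones. *)
HB.saturate prod.

(* The edges form a type of their own, so loops and parallel edges are
   allowed; the edge e is directed from src e to tgt e. *)
Record ograph := OGraph {
  vertex : finType;
  edge : finType;
  src : edge -> vertex;
  tgt : edge -> vertex
}.

Section OrientedGraphs.
Variable G : ograph.

Definition out_edges (v : vertex G) : {set edge G} := [set e | src e == v].
Definition in_edges (v : vertex G) : {set edge G} := [set e | tgt e == v].

(* Adjacency in the underlying undirected graph of G - F. *)
Definition adj_del (F : {set edge G}) : rel (vertex G) :=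
  [rel x y | [exists e, (e \notin F) &&
     (((src e == x) && (tgt e == y)) || ((src e == y) && (tgt e == x)))]].

Definition edge_connected (k : nat) : Prop :=
  (1 < #|vertex G|)%N /\
  forall F : {set edge G}, (#|F| < k)%N ->
    forall x y : vertex G, connect (adj_del F) x y.

Definition is_flow (A : zmodType) (phi : edge G -> A) : bool :=
  [forall v, \sum_(e in out_edges v) phi e == \sum_(e in in_edges v) phi e].

Definition nowhere_zero (A : zmodType) (phi : edge G -> A) : bool :=
  [forall e, phi e != 0].

Definition nz_flows (A : finZmodType) : {set {ffun edge G -> A}} :=
  [set phi : {ffun edge G -> A} | is_flow phi && nowhere_zero phi].

End OrientedGraphs.

(* Main.v *)
Require Import Defs.
From mathcomp Require Import all_boot all_order all_algebra.
From mathcomp Require Import reals exp.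
From mathcomp Require Import zify ring.

Set Implicit Arguments.
Unset Strict Implicit.
Unset Printing Implicit Defensive.

Import Order.TTheory GRing.Theory Num.Theory.
Local Open Scope ring_scope.

(* Part 2.  A 4-edge-connected graph has two edge-disjoint spanning connected
   subgraphs: a minimal vertex set X spanning at least 2|X| - 2 edges contains a
   sparse subgraph with exactly 2|X| - 2 edges, which splits into two spanning
   trees by deleting vertices of degree 2 or splitting off vertices of degree 3,
   and then X is contracted.  They give a nowhere-zero flow phi over Z_2 x Z_2.
   Some nonzero value d is taken on a set Z of at most m/3 edges, and phi + d h
   is nowhere-zero for each of the at least 2^(m-|Z|-n+1) Z_2-flows h vanishing
   on Z.

   Part 1.  Seymour's argument gives an even subgraph S and a Z_3-flow nonzero
   off S, growing a vertex set by closed trails that meet it in two edges.  S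
   carries a Z_3-flow psi with support S.  For every Z_3-flow h supported on S,
   one of h, h + psi, h - psi creates at most |S|/3 zeros in the Z_3-flow, and
   these lie in S; so the Z_2-flow 1_S can be changed by any Z_2-flow vanishing
   on these zeros.  Counting the pairs gives the bound. *)

(** * Boundaries of edge functions and flows along paths *)

Section Boundary.
Variables (V E : finType) (s t : E -> V).
Implicit Types (X Y W : {set V}) (T : {set E}).

Definition bnd (A : zmodType) (phi : E -> A) (v : V) : A :=
  \sum_(e | s e == v) phi e - \sum_(e | t e == v) phi e.

Lemma eq_bnd (A : zmodType) (phi psi : E -> A) : phi =1 psi -> bnd phi =1 bnd psi.
Proof. by move=> eq v; rewrite /bnd; congr (_ - _); apply: eq_bigr. Qed.

Lemma bndD (A : zmodType) (phi psi : E -> A) v :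
  bnd (fun e => phi e + psi e) v = bnd phi v + bnd psi v.
Proof. by rewrite /bnd !big_split /= opprD addrACA. Qed.

Lemma bndN (A : zmodType) (phi : E -> A) v : bnd (fun e => - phi e) v = - bnd phi v.
Proof. by rewrite /bnd !sumrN opprB opprK addrC. Qed.

Lemma bndB (A : zmodType) (phi psi : E -> A) v :
  bnd (fun e => phi e - psi e) v = bnd phi v - bnd psi v.
Proof. by rewrite bndD bndN. Qed.

Lemma eq_bnd_at (A : zmodType) (phi psi : E -> A) v :
  (forall e, s e = v \/ t e = v -> phi e = psi e) -> bnd phi v = bnd psi v.
Proof. by move=> H; congr (_ - _); apply: eq_bigr => e /eqP ev; apply: H; [left|right]. Qed.

Lemma bnd_eq0 (A : zmodType) (phi : E -> A) v :
  (forall e, phi e != 0 -> s e != v /\ t e != v) -> bnd phi v = 0.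
Proof.
by move=> H; rewrite /bnd !big1 ?subr0 // => e ev; apply/eqP/contraT => /H []; rewrite ev.
Qed.

Lemma bnd0 (A : zmodType) v : bnd (fun=> 0 : A) v = 0.
Proof. by rewrite bnd_eq0 // => e; rewrite eqxx. Qed.

Lemma bnd_sum (A : zmodType) (I : finType) (P : pred I) (phi : I -> E -> A) v :
  bnd (fun e => \sum_(i | P i) phi i e) v = \sum_(i | P i) bnd (phi i) v.
Proof.
by rewrite /bnd exchange_big [X in _ - X]exchange_big -sumrB.
Qed.

Lemma bnd_morph (A B : zmodType) (f : A -> B) (phi : E -> A) v :
  f 0 = 0 -> {morph f : x y / x + y} -> bnd (f \o phi) v = f (bnd phi v).
Proof.
move=> f0 fD; rewrite /bnd fD !(big_morph f fD f0); congr (_ + _).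
by apply/eqP; rewrite eq_sym -addr_eq0 -(big_morph f fD f0) -fD addNr f0.
Qed.

Lemma sum_bnd (A : zmodType) (phi : E -> A) X :
  \sum_(v in X) bnd phi v = \sum_(e | s e \in X) phi e - \sum_(e | t e \in X) phi e.
Proof.
have aux (r : E -> V) : \sum_(v in X) \sum_(e | r e == v) phi e = \sum_(e | r e \in X) phi e.
  rewrite (exchange_big_dep (fun e => r e \in X)) /=.
    by apply: eq_bigr => e eX; rewrite (big_pred1 (r e)) // => v /=;
      rewrite andbC eq_sym; case: eqP => // ->; rewrite eX.
  by move=> v e vX /eqP ->.
by rewrite sumrB !aux.
Qed.

Lemma bnd_single (A : zmodType) (k : A) e0 v :
  bnd (fun e => if e == e0 then k else 0) v = k *+ (v == s e0) - k *+ (v == t e0).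
Proof.
have aux (r : E -> V) : \sum_(e | r e == v) (if e == e0 then k else 0) = k *+ (v == r e0).
  rewrite -big_mkcondr; have [->|nrv] := eqVneq v (r e0).
    by rewrite (big_pred1 e0) // => e /=; case: (e =P e0) => [->|]; rewrite ?eqxx ?andbF.
  by rewrite big_pred0 // => e; case: (e =P e0) => [->|]; rewrite ?andbF // eq_sym (negPf nrv).
by rewrite /bnd !aux.
Qed.

Definition inside W : {set E} := [set e | (s e \in W) && (t e \in W)].
Definition cut W : {set E} := [set e | (s e \in W) != (t e \in W)].

(** An edge with both ends in [X] is counted once with each sign and an edge with no end in [X] not
    at all, so only edges of the cut could contribute. *)
Lemma sum_bnd_cut (A : zmodType) (phi : E -> A) X :
  (forall e, phi e != 0 -> e \notin cut X) -> \sum_(v in X) bnd phi v = 0.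
Proof.
move=> H; rewrite sum_bnd; apply/eqP; rewrite subr_eq0; apply/eqP.
rewrite big_mkcond [RHS]big_mkcond; apply: eq_bigr => e _.
have [->|/H] := eqVneq (phi e) 0; first by rewrite !if_same.
by rewrite inE negbK => /eqP ->.
Qed.

(** Edges in [p] may be traversed forwards, those in [q] backwards. With [p = q] this is undirected
    adjacency; the asymmetric form serves augmenting paths. *)
Definition residual (p q : pred E) : rel V :=
  [rel u v | [exists e, [&& p e, s e == u & t e == v] || [&& q e, t e == u & s e == v]]].

(** Push one unit along a path, with sign -1 where an edge is traversed backwards. A path without
    repeated vertices uses no edge twice, which keeps the values in {-1, 0, 1}. *)
Lemma path_flow (p q : pred E) a b : connect (residual p q) a b ->
  exists g : E -> int,
    (forall v, bnd g v = (v == a)%:R - (v == b)%:R) /\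
    (forall e, [|| g e == 0, (g e == 1) && p e | (g e == -1) && q e]).
Proof.
case/connectP => l0 /shortenP [l pl ul _] ->; clear l0.
suff [g [g1 g2 _]] : exists g : E -> int,
  [/\ (forall v, bnd g v = (v == a)%:R - (v == last a l)%:R),
    (forall e, [|| g e == 0, (g e == 1) && p e | (g e == -1) && q e]) &
    (forall e, g e != 0 -> (s e \in a :: l) && (t e \in a :: l))] by exists g.
elim: l a pl ul => [|c l IH] a.
  by exists (fun=> 0); split => [v|e|e]; rewrite ?bnd0 ?subrr ?eqxx.
rewrite [path _ _ _]/= [uniq _]/= => /andP[/existsP[e0 He0] pl] /andP[al ul].
have [g [g1 g2 g3]] := IH c pl ul.
have ge0 : g e0 = 0.
  apply/eqP/contraT => /g3 /andP[se te]; case/orP: He0 => /and3P[_ /eqP Ea _];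
  by rewrite -Ea ?se ?te in al.
have ac : a != c by apply: contraNneq al => ->; rewrite inE eqxx.
pose k : int := if p e0 && (s e0 == a) && (t e0 == c) then 1 else -1.
exists (fun e => g e + (if e == e0 then k else 0)); split.
- move=> v; rewrite bndD g1 /=.
  have -> : bnd (fun e => if e == e0 then k else 0) v = (v == a)%:R - (v == c)%:R; last by ring.
  rewrite bnd_single.
  rewrite /k; case: ifP => [/andP[/andP[_ /eqP-> /eqP->]]|kk].
    by [].
  case/orP: He0 => [/and3P[p0 s0 t0]|/and3P[_ /eqP-> /eqP->]]; first by rewrite p0 s0 t0 in kk.
  by rewrite !mulNrn; ring.
- move=> e; have [->|ne] := eqVneq e e0; last by rewrite addr0.
  rewrite ge0 add0r /k; case: ifP => [/andP[/andP[-> _ _]]|kk]; first by rewrite eqxx orbT.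
  case/orP: He0 => [/and3P[p0 s0 t0]|/and3P[-> _ _]]; first by rewrite p0 s0 t0 in kk.
  by rewrite eqxx !orbT.
- move=> e; have [->|ne] := eqVneq e e0.
    by move=> _; case/orP: He0 => /and3P[_ /eqP-> /eqP->]; rewrite !inE !eqxx !orbT.
  by rewrite addr0 => /g3 /andP[se te]; rewrite in_cons se orbT in_cons te orbT.
Qed.

(** Connectedness of [T] on [W] in cut form, which passes through contractions and vertex deletions
    without handling paths. *)
Definition spans T W := forall Y, Y \subset W -> Y != set0 -> Y != W ->
  exists2 e, e \in T & e \in cut Y.

Lemma spans_connect T W x y : spans T W -> T \subset inside W ->
  x \in W -> y \in W -> connect (residual (mem T) (mem T)) x y.
Proof.
move=> sT TW xW yW; apply/contraT => nxy.
pose Y := [set v in W | connect (residual (mem T) (mem T)) x v].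
have [|||e eT] := sT Y.
- by apply/subsetP => v; rewrite inE => /andP[].
- by apply/set0Pn; exists x; rewrite inE xW connect0.
- by apply: contraNneq nxy => YW; move: yW; rewrite -{1}YW inE => /andP[].
have:= subsetP TW e eT; rewrite !inE => /andP[-> ->] /=.
case/negP; apply/eqP; apply/idP/idP => H; apply: (connect_trans H);
  apply: connect1; apply/existsP; exists e;
by rewrite /= eT !eqxx ?orbT.
Qed.

(** Send [b v] units from every [v] to one root [x] along paths in [T]; what is collected at [x]
    vanishes because [b] sums to zero. *)
Lemma spans_realize (A : zmodType) T W (b : V -> A) :
  spans T W -> T \subset inside W -> \sum_(v in W) b v = 0 ->
  exists phi : E -> A, (forall e, e \notin T -> phi e = 0) /\
    (forall v, v \in W -> bnd phi v = b v).
Proof.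
move=> sT TW b0; have [->|/set0Pn [x xW]] := eqVneq W set0.
  by exists (fun=> 0); split => // v; rewrite inE.
have /fin_all_exists [g Hg] : forall v, exists g : E -> int, v \in W ->
    (forall w, bnd g w = (w == v)%:R - (w == x)%:R) /\ (forall e, e \notin T -> g e = 0).
  move=> v; have [vW|_] := boolP (v \in W); last by exists (fun=> 0).
  have [g [g1 g2]] := path_flow (spans_connect sT TW vW xW).
  exists g => _; split=> // e eT; have:= g2 e.
  by rewrite !inE (negPf eT) !andbF !orbF => /eqP.
exists (fun e => \sum_(v in W) b v *~ g v e); split => [e eT|w wW].
  by rewrite big1 // => v vW; rewrite (Hg v vW).2.
rewrite bnd_sum.
rewrite (eq_bigr (fun v => (b v *+ (w == v)) - (b v *+ (w == x)))).
  rewrite sumrB [X in _ - X]sumrMnl b0 mul0rn subr0 (bigD1 w) //= eqxx mulr1n big1 ?addr0 // => v /andP[_].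
  by rewrite eq_sym => /negPf ->.
move=> v vW; have -> : bnd (fun e => b v *~ g v e) w = b v *~ bnd (g v) w.
  by rewrite /bnd mulrzBr !mulrz_sumr.
by rewrite (Hg v vW).1 mulrzBr !mulrz_nat.
Qed.

End Boundary.

Lemma exists_subset_card (T : finType) (A : {set T}) k : (k <= #|A|)%N ->
  exists2 B : {set T}, B \subset A & #|B| = k.
Proof.
move=> kA; exists [set x in take k (enum A)].
  by apply/subsetP => x; rewrite inE => /mem_take; rewrite mem_enum.
rewrite cardsE; have /card_uniqP -> := take_uniq k (enum_uniq A).
by rewrite size_takel // -cardE.
Qed.

(** * Two edge-disjoint connected spanning subgraphs *)

Section TreePacking.
Variables (V E : finType).
Implicit Types (s t : E -> V) (X Y W : {set V}) (F T : {set E}).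

(** Double counting: each edge lies in the cut of at most two single vertices, and a loop in
    none. *)
Lemma sum_card_cut s t F W :
  (\sum_(v in W) #|F :&: cut s t [set v]| <= 2 * #|F|)%N.
Proof.
have -> : (\sum_(v in W) #|F :&: cut s t [set v]| =
    \sum_(e in F) \sum_(v in W) (e \in cut s t [set v] : nat))%N.
  rewrite exchange_big; apply: eq_bigr => v _.
  by rewrite -sum1_card -big_mkcondr; apply: eq_bigl => e; rewrite inE.
rewrite mulnC -sum_nat_const; apply: leq_sum => e _.
have aux (r : E -> V) : (\sum_(v in W) (r e == v : nat) <= 1)%N.
  rewrite -big_mkcondr sum1_card; apply: leq_trans (_ : #|[set r e]| <= 1)%N; last by rewrite cards1.
  by apply: subset_leq_card; apply/subsetP => v; rewrite !inE => /andP[_]; rewrite eq_sym.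
apply: leq_trans (leq_add (aux s) (aux t)); rewrite -big_split; apply: leq_sum => v _.
by rewrite /= !inE; case: (s e == v); case: (t e == v).
Qed.

(** Contraction without quotient types: edges keep their type, ends in [X] are redirected to the
    representative [x0], and [x0 |: (W :\: X)] is the new vertex set. *)
Definition contract X (x0 v : V) := if v \in X then x0 else v.

Lemma contract_in X W x0 v : v \in W -> contract X x0 v \in x0 |: (W :\: X).
Proof. by move=> vW; rewrite /contract; case: ifP => vX; rewrite !inE ?eqxx // vX vW orbT. Qed.

Definition two_spanning s t F W := exists T1 T2 : {set E},
  [/\ T1 \subset F, T2 \subset F, [disjoint T1 & T2], spans s t T1 W & spans s t T2 W].

(** A set [Y] that splits [X] is crossed by [T] inside [X]. Any other [Y] contains or avoids all of
    [X], so it comes from a vertex set of the contracted graph, where [T'] crosses it. *)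
Lemma spans_contract s t T T' X W x0 : X \subset W -> x0 \in X ->
  T \subset inside s t X -> spans s t T X -> T' \subset inside s t W ->
  spans (contract X x0 \o s) (contract X x0 \o t) T' (x0 |: (W :\: X)) ->
  spans s t (T :|: T') W.
Proof.
move=> XW x0X TX sT TW sT' Y YW Y0 YnW.
have project : (forall v, v \in W -> (contract X x0 v \in Y :&: (x0 |: (W :\: X))) = (v \in Y)) ->
    exists2 e, e \in T :|: T' & e \in cut s t Y.
  move=> key; have [|||e eT eY] := sT' (Y :&: (x0 |: (W :\: X))); first exact: subsetIr.
  - have [y yY] := set0Pn _ Y0; apply/set0Pn; exists (contract X x0 y).
    by rewrite key // (subsetP YW).
  - apply: contraNneq YnW => eq; rewrite eqEsubset YW; apply/subsetP => w wW.
    by rewrite -key // eq contract_in.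
  exists e; first by rewrite inE eT orbT.
  move: eY (subsetP TW e eT); rewrite inE /= [e \in inside _ _ _]inE => + /andP[sW tW].
  by rewrite !key // inE.
have [/eqP YX0|YX0] := boolP (Y :&: X == set0).
  have nX v : v \in X -> v \in Y = false.
    by move=> vX; apply/negP => vY; have := in_set0 v; rewrite -YX0 inE vY vX.
  apply: project => v vW; rewrite /contract; case: ifP => vX; rewrite !inE ?eqxx ?vX ?vW ?orbT ?andbT //.
  by rewrite !nX.
have [/eqP YXX|YXX] := boolP (Y :&: X == X).
  apply: project => v vW; rewrite /contract; case: ifP => vX; rewrite !inE ?eqxx ?vX ?vW ?orbT ?andbT //.
  have -> : x0 \in Y by move: x0X; rewrite -YXX inE => /andP[].
  by move: vX; rewrite -YXX inE => /andP[->].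
have [|||e eT eY] := sT (Y :&: X); rewrite ?subsetIr //.
exists e; first by rewrite inE eT.
by have:= subsetP TX e eT; move: eY; rewrite !inE => + /andP[sX tX]; rewrite sX tX !andbT.
Qed.

Lemma two_spanning_contract s t F1 F2 X W x0 : X \subset W -> x0 \in X ->
  F1 \subset inside s t X -> F2 \subset inside s t W :\: inside s t X ->
  two_spanning s t F1 X ->
  two_spanning (contract X x0 \o s) (contract X x0 \o t) F2 (x0 |: (W :\: X)) ->
  two_spanning s t (F1 :|: F2) W.
Proof.
move=> XW x0X F1X F2X [T1 [T2 [TF1 TF2 dT sT1 sT2]]] [U1 [U2 [UF1 UF2 dU sU1 sU2]]].
have F2W : F2 \subset inside s t W by apply: subset_trans F2X (subsetDl _ _).
have dF : [disjoint F1 & F2].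
  rewrite disjoint_sym; move: F2X; rewrite subsetD => /andP[_ H]; apply: disjointWr F1X H.
exists (T1 :|: U1), (T2 :|: U2); split.
- exact: setUSS.
- exact: setUSS.
- rewrite -setI_eq0 setIUl !setIUr !setU_eq0 !setI_eq0 dT dU andbT /= (disjointW TF1 UF2 dF) /=.
  by rewrite disjoint_sym (disjointW TF2 UF1 dF).
- by apply: spans_contract sU1; rewrite ?(subset_trans TF1) ?(subset_trans UF1).
- by apply: spans_contract sU2; rewrite ?(subset_trans TF2) ?(subset_trans UF2).
Qed.

(** This is (2,2)-sparsity, the counting condition satisfied by unions of two forests. On singletons
    it excludes loops. *)
Definition sparse s t F W :=
  forall Y, Y \subset W -> Y != set0 -> (#|F :&: inside s t Y| + 2 <= 2 * #|Y|)%N.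

Lemma spans_card1 s t T W : (#|W| <= 1)%N -> spans s t T W.
Proof.
move=> W1 Y YW Y0; case/negP; rewrite eqEcard YW.
by apply: leq_trans W1 _; rewrite card_gt0.
Qed.

(** Deleting [v] loses only the cut that isolates [v], which shows up as one of its two sides. *)
Lemma subsetD1P Y W v : Y \subset W -> Y != set0 -> Y != W -> v \in W ->
  [\/ (Y :&: (W :\ v) != set0) /\ (Y :&: (W :\ v) != W :\ v), Y = [set v] | Y = W :\ v].
Proof.
move=> YW Y0 YnW vW; have [/eqP Y1|Y1] := boolP (Y :&: (W :\ v) == set0).
  constructor 2; apply/eqP; rewrite eqEsubset sub1set.
  have sY : Y \subset [set v].
    apply/subsetP => y yY; rewrite inE; apply/contraT => yv.
    by have := in_set0 y; rewrite -Y1 !inE yY yv (subsetP YW).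
  rewrite sY; have [y yY] := set0Pn _ Y0.
  by have := subsetP sY y yY; rewrite inE => /eqP <-.
have [/eqP Y2|Y2] := boolP (Y :&: (W :\ v) == W :\ v); last by constructor 1.
constructor 3; have sWY : W :\ v \subset Y by rewrite -Y2 subsetIl.
apply/eqP; rewrite eqEsubset sWY andbT; apply/subsetP => y yY; rewrite !inE (subsetP YW) // andbT.
apply: contraNneq YnW => yv; rewrite eqEsubset YW; apply/subsetP => w wW.
have [->|wv] := eqVneq w v; first by rewrite -yv.
by apply: (subsetP sWY); rewrite !inE wv.
Qed.

(** [v] is attached as a leaf: [e] crosses the cut isolating [v], and every other cut restricts to
    one of [W :\ v]. *)
Lemma spansU1 s t T W v e : v \in W -> spans s t T (W :\ v) -> T \subset inside s t (W :\ v) ->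
  e \in cut s t [set v] -> e \in inside s t W -> spans s t (e |: T) W.
Proof.
move=> vW sT TW ev eW Y YW Y0 YnW.
case: (subsetD1P YW Y0 YnW vW) => [[Y1 Y2]|->|->].
- have [|||f fT fY] := sT (Y :&: (W :\ v)); rewrite ?subsetIr //; exists f; first by rewrite inE fT orbT.
  have := subsetP TW f fT; rewrite inE => /andP[sf tf].
  by move: fY; rewrite !inE -!in_setD1 sf tf !andbT.
- by exists e; rewrite // !inE eqxx.
- exists e; first by rewrite !inE eqxx.
  by move: ev eW; rewrite !inE => + /andP[-> ->]; rewrite !andbT; case: (s e == v); case: (t e == v).
Qed.

Lemma two_spanning_sub s t F F' W : F \subset F' ->
  two_spanning s t F W -> two_spanning s t F' W.
Proof.
move=> FF' [T1 [T2 [T1F T2F d s1 s2]]]; exists T1, T2.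
by split; rewrite ?(subset_trans _ FF').
Qed.

Definition other s t e v := if s e == v then t e else s e.

Lemma other_in s t e v W : e \in cut s t [set v] -> e \in inside s t W -> other s t e v \in W :\ v.
Proof.
rewrite !inE /other => sv /andP[sW tW]; move: sv.
by case: ifP => [_|->]; rewrite ?sW ?tW //; case: (t e == v).
Qed.

Lemma cut_other s t e v Y : e \in cut s t [set v] ->
  (e \in cut s t Y) = ((v \in Y) != (other s t e v \in Y)).
Proof.
by rewrite !inE /other; case: (s e =P v) => [->|_]; case: (t e =P v) => [->|_] // _; rewrite eq_sym.
Qed.

(* Splitting v off: e1, e2 are replaced by a single edge e1 joining their other ends. *)
Lemma two_spanning_split s t F W v e1 e2 e3 : v \in W -> F \subset inside s t (W :\ v) ->
  uniq [:: e1; e2; e3] -> {subset [:: e1; e2; e3] <= cut s t [set v] :&: inside s t W} ->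
  (forall e, e \in [:: e1; e2; e3] -> e \notin F) ->
  two_spanning (fun e => if e == e1 then other s t e1 v else s e)
    (fun e => if e == e1 then other s t e2 v else t e) (e1 |: F) (W :\ v) ->
  two_spanning s t ([set e in [:: e1; e2; e3]] :|: F) W.
Proof.
set S := [:: e1; e2; e3] => vW FW uS Scut SF [T1 [T2 [T1F T2F d s1 s2]]].
pose s' e := if e == e1 then other s t e1 v else s e.
pose t' e := if e == e1 then other s t e2 v else t e.
have e1S : e1 \in S by rewrite inE eqxx.
have e2S : e2 \in S by rewrite !inE eqxx orbT.
have e3S : e3 \in S by rewrite !inE eqxx !orbT.
have [e12 e13 e23] : [/\ e1 != e2, e1 != e3 & e2 != e3].
  by move: uS; rewrite /= !inE negb_or andbT => /andP[/andP[-> ->] ->].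
(* By symmetry, [T1] is the part that may contain the new edge. *)
wlog e1T2 : T1 T2 T1F T2F d s1 s2 / e1 \notin T2.
  move=> WL; have [e1T2|e1T2] := boolP (e1 \in T2); last exact: (WL T1 T2).
  apply: (WL T2 T1); rewrite // 1?disjoint_sym //.
  by apply/negP => e1T1; move: d; rewrite -setI_eq0 => /eqP/setP/(_ e1); rewrite !inE e1T1 e1T2.
have nF e T : T \subset e1 |: F -> e \in S -> e != e1 -> e \notin T.
  move=> TF eS ne; apply: contra (subsetP TF e) _; rewrite !inE negb_or ne; exact: SF.
have Sc e : e \in S -> e \in cut s t [set v] by move/Scut; rewrite inE => /andP[].
have SW e : e \in S -> e \in inside s t W by move/Scut; rewrite inE => /andP[].
have T2F' : T2 \subset F.
  apply/subsetP => e eT; have := subsetP T2F e eT; rewrite in_setU1 => /orP[/eqP ee1|//].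
  by rewrite -ee1 eT in e1T2.
have SS e : e \in S -> e \in [set e in S] :|: F by rewrite in_setU in_set => ->.
(* [T1] receives both halves of the split edge, while [T2] takes [v] as a leaf through [e3]. *)
exists (e1 |: (e2 |: T1)), (e3 |: T2); split.
- rewrite !subUset !sub1set !SS //=; apply: subset_trans T1F _.
  by rewrite subUset sub1set SS // subsetUr.
- by rewrite subUset sub1set SS //= (subset_trans T2F') // subsetUr.
- rewrite -setI_eq0 !setIUl !setIUr !setU_eq0 !setI_eq0 d !disjoints1 !inE e1T2 e13 e23 /=.
  by rewrite (nF e2) 1?eq_sym //= disjoint_sym disjoints1 (nF e3) 1?eq_sym.
- move=> Y YW Y0 YnW; case: (subsetD1P YW Y0 YnW vW) => [[Y1 Y2]|->|->].
  + have [|||f fT fY] := s1 (Y :&: (W :\ v)); rewrite ?subsetIr //.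
    (* If the split edge crosses [Y], the other ends of [e1] and [e2] are on different sides, so one
       of them is opposite to [v]. *)
    have [fe|fe] := eqVneq f e1.
      move: fY; rewrite inE fe eqxx !in_setI !other_in ?Sc ?SW // !andbT => oo.
      have [e1Y|e1Y] := boolP (e1 \in cut s t Y); first by exists e1; rewrite ?setU11.
      exists e2; first by rewrite !inE eqxx orbT.
      rewrite (cut_other _ (Sc _ e2S)); move: e1Y oo; rewrite (cut_other _ (Sc _ e1S)) negbK => /eqP ->.
      by case: (_ \in Y); case: (_ \in Y).
    exists f; first by rewrite !inE fT !orbT.
    have := subsetP T1F f fT; rewrite in_setU1 (negPf fe) => /(subsetP FW); rewrite inE => /andP[sf tf].
    by move: fY; rewrite inE (negPf fe) !in_setI sf tf !andbT inE.
  + by exists e1; rewrite ?Sc // setU11.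
  + exists e1; rewrite ?setU11 // (cut_other _ (Sc _ e1S)) other_in ?Sc ?SW //.
    by rewrite !inE eqxx.
apply: spansU1 vW _ (subset_trans T2F' FW) (Sc _ e3S) (SW _ e3S).
move=> Y YW Y0 YnW; have [e eT eY] := s2 Y YW Y0 YnW; exists e => //.
by move: eY; rewrite !inE; have -> : (e == e1) = false by apply: contraNF e1T2 => /eqP <-.
Qed.

(** Induction on [#|W|]. A proper tight set [X] of at least two vertices, one spanning exactly
    [2 * #|X| - 2] edges, is contracted. If there is none, some vertex has degree at most 3, and the
    absence of tight sets is what keeps the graph sparse when an edge is added by splitting. *)
Lemma two_spanning_sparse s t F W : F \subset inside s t W -> W != set0 ->
  (#|F| + 2 = 2 * #|W|)%N -> sparse s t F W -> two_spanning s t F W.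
Proof.
have [k] := ubnP #|W|; elim: k => // k IH in s t F W *; rewrite ltnS => Wk FW W0 cF sF.
have [X /and4P[XW X1 XnW /eqP cX]|noX] := pickP (fun X : {set V} =>
    [&& X \subset W, (1 < #|X|)%N, (#|X| < #|W|)%N & (#|F :&: inside s t X| + 2 == 2 * #|X|)%N]).
  have /card_gt0P [x0 x0X] : (0 < #|X|)%N by lia.
  have cF2 := cardsID (inside s t X) F.
  have cWX : (#|x0 |: (W :\: X)| = 1 + #|W| - #|X|)%N.
    by rewrite cardsU1 !inE x0X /= cardsDS //; lia.
  rewrite -(setID F (inside s t X)); apply: (two_spanning_contract (x0 := x0) XW x0X).
  - exact: subsetIr.
  - exact: setSD.
  - apply: IH; rewrite ?subsetIr //; [lia | by rewrite -card_gt0; lia |].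
    move=> Y YX Y0; apply: leq_trans (sF Y _ Y0); last exact: subset_trans XW.
    by rewrite leq_add2r subset_leq_card // setSI // subsetIl.
  - apply: IH; [lia | | by apply/set0Pn; exists x0; rewrite setU11 | lia |].
      apply/subsetP => e /setDP[eF _]; have := subsetP FW e eF.
      by rewrite inE [e \in inside _ _ _]inE => /andP[sW tW]; rewrite !contract_in.
    (* A set through [x0] is lifted to [Y :|: X]: this spans the edges counted for [Y] and the
       [2 * #|X| - 2] edges of [X], and has [#|Y| + #|X| - 1] vertices. *)
    move=> Y YW Y0; have [x0Y|x0Y] := boolP (x0 \in Y).
      have cY := cardsUI Y X.
      have eYX : Y :&: X = [set x0].
        apply/setP => v; rewrite !inE; apply/andP/eqP => [[vY vX]|->] //.
        by have := subsetP YW v vY; rewrite !inE vX orbF => /eqP.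
      rewrite eYX cards1 in cY.
      have /sF : Y :|: X \subset W.
        by rewrite subUset XW andbT (subset_trans YW) // subUset subsetDl sub1set (subsetP XW).
      have YX0 : Y :|: X != set0 by apply/set0Pn; exists x0; rewrite inE x0Y.
      move=> /(_ YX0); set P := (F :\: _) :&: _; set Q := F :&: inside s t X in cX *.
      have PQ0 : P :&: Q = set0.
        by apply/setP => e; rewrite !inE; case: (s e \in X); case: (t e \in X); rewrite ?andbF.
      have : P :|: Q \subset F :&: inside s t (Y :|: X).
        have inYX v : contract X x0 v \in Y -> (v \in Y) || (v \in X).
          by rewrite /contract; case: ifP => [_ _|_ ->//]; rewrite orbT.
        apply/subsetP => e; rewrite !inE /= => /orP[/andP[/andP[_ ->] /andP[/inYX -> /inYX ->]] //|].
        by case/andP=> -> /andP[-> ->]; rewrite !orbT.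
      move/subset_leq_card; have := cardsUI P Q; rewrite PQ0 cards0; lia.
    apply: leq_trans (sF Y _ Y0); last first.
      apply/subsetP => y yY; have := subsetP YW y yY; rewrite !inE => /orP[/eqP yx|/andP[] //].
      by rewrite -yx yY in x0Y.
    rewrite leq_add2r subset_leq_card //; apply/subsetP => e; rewrite !inE /contract /=.
    by case/andP=> /andP[_ ->]; do 2!case: ifP; rewrite ?(negPf x0Y) ?andbF.
have [W1|W1] := leqP #|W| 1.
  by exists set0, set0; rewrite !sub0set -setI_eq0 setI0; split=> //; apply: spans_card1.
(* Otherwise the degrees add up to at least [4 * #|W|], more than twice the number of edges. *)
have [v vW cv] : exists2 v, v \in W & (#|F :&: cut s t [set v]| <= 3)%N.
  apply/exists_inP/contraT; rewrite negb_exists_in => /forall_inP H.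
  have := sum_card_cut s t F W.
  have : (\sum_(v in W) 4 <= \sum_(v in W) #|F :&: cut s t [set v]|)%N.
    by apply: leq_sum => v vW; rewrite ltnNge H.
  rewrite sum_nat_const; lia.
have cWv : (#|W :\ v| = #|W| - 1)%N by have := cardsD1 v W; rewrite vW; lia.
have Wv0 : W :\ v != set0 by rewrite -card_gt0; lia.
have WvW : W :\ v \subset W by apply: subsetDl.
set F0 := F :&: inside s t (W :\ v).
have eF : F = (F :&: cut s t [set v]) :|: F0.
  apply/eqP; rewrite eqEsubset subUset !subsetIl !andbT; apply/subsetP => e eF.
  have := subsetP FW e eF; rewrite !inE eF /= => /andP[-> ->]; rewrite !andbT.
  have : ~~ ((s e == v) && (t e == v)).
    have := sF [set v]; rewrite sub1set vW -card_gt0 cards1 => /(_ isT isT) Hv.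
    have {Hv} : #|F :&: inside s t [set v]| = 0 by lia.
    by move/eqP; rewrite cards_eq0 => /eqP/setP/(_ e); rewrite !inE eF /= => ->.
  by case: (s e == v); case: (t e == v).
have cF0 : (#|F| = #|F :&: cut s t [set v]| + #|F0|)%N.
  rewrite [in LHS]eF; have := cardsUI (F :&: cut s t [set v]) F0.
  suff -> : F :&: cut s t [set v] :&: F0 = set0 by rewrite cards0; lia.
  by apply/setP => e; rewrite !inE; case: (s e == v); case: (t e == v); rewrite ?andbF.
have sF0 : sparse s t F0 (W :\ v).
  move=> Y YW Y0; apply: leq_trans (sF Y _ Y0); last exact: subset_trans WvW.
  by rewrite leq_add2r subset_leq_card // setSI // subsetIl.
(* Sparsity of [W :\ v] forces at least two edges at [v]. *)
have := sF _ WvW Wv0; rewrite -/F0 => cF0'.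
have [C2|C2] := leqP #|F :&: cut s t [set v]| 2.
  have /eqP/cards2P [e1 [e2 [e12 eC]]] : #|F :&: cut s t [set v]| = 2 by lia.
  have HC e : e \in F :&: cut s t [set v] -> [/\ e \in cut s t [set v], e \in inside s t W & e \notin F0].
    rewrite in_setI => /andP[eF' ec]; split => //; first exact: (subsetP FW).
    by move: ec; rewrite !inE; case: (s e == v); case: (t e == v); rewrite ?andbF.
  have /HC [e1c e1W e1F] : e1 \in F :&: cut s t [set v] by rewrite eC !inE eqxx.
  have /HC [e2c e2W e2F] : e2 \in F :&: cut s t [set v] by rewrite eC !inE eqxx orbT.
  have Wvk : (#|W :\ v| < k)%N by rewrite cWv; clear - Wk W1; lia.
  have cF0W : (#|F0| + 2 = 2 * #|W :\ v|)%N by rewrite cWv; clear - cF cF0 C2 cF0' W1 cWv; lia.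
  have [T1 [T2 [T1F T2F d s1 s2]]] := IH s t F0 (W :\ v) Wvk (subsetIr _ _) Wv0 cF0W sF0.
  have F0W : F0 \subset inside s t (W :\ v) by apply: subsetIr.
  exists (e1 |: T1), (e2 |: T2); split.
  - by rewrite eF eC subUset sub1set in_setU set21 /= (subset_trans T1F) // subsetUr.
  - by rewrite eF eC subUset sub1set in_setU set22 /= (subset_trans T2F) // subsetUr.
  - rewrite -setI_eq0 setIUl !setIUr !setU_eq0 !setI_eq0 d !disjoints1 inE e12 andbT.
    rewrite (contra (subsetP T2F e1) e1F) disjoint_sym disjoints1.
    by rewrite (contra (subsetP T1F e2) e2F).
  - exact: spansU1 vW s1 (subset_trans T1F F0W) e1c e1W.
  - exact: spansU1 vW s2 (subset_trans T2F F0W) e2c e2W.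
(* If the three edges at [v] all had the same other end, that end and [v] would span three edges,
   one more than sparsity allows. So some two of them can be split off without creating a loop. *)
suff key e1 e2 e3 : uniq [:: e1; e2; e3] -> F :&: cut s t [set v] = [set e in [:: e1; e2; e3]] ->
    other s t e1 v != other s t e2 v -> two_spanning s t F W.
  have C3 : #|F :&: cut s t [set v]| = 3 by lia.
  have /card_gt2P [x [y [z [[xC yC zC] [xy yz zx]]]]] := C2.
  have uS : uniq [:: x; y; z] by rewrite /= !inE negb_or xy yz eq_sym zx.
  have eC : F :&: cut s t [set v] = [set e in [:: x; y; z]].
    apply/esym/eqP; rewrite eqEcard C3 cardsE (card_uniqP uS) leqnn andbT.
    by apply/subsetP => e; rewrite !in_set !inE => /or3P[] /eqP->; move: xC yC zC; rewrite !inE.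
  have [oxy|] := eqVneq (other s t x v) (other s t y v); last exact: key uS eC.
  have [oyz|] := eqVneq (other s t y v) (other s t z v); last first.
    apply: (key y z x); first exact: etrans (rot_uniq 1 [:: x; y; z]) uS.
    by rewrite eC; apply/setP => e; rewrite !inE orbC -orbA.
  have := sF [set v; other s t x v]; have HW e : e \in F :&: cut s t [set v] ->
      (other s t e v \in W) /\ e \in inside s t [set v; other s t e v].
    rewrite in_setI => /andP[eF' ec]; split.
      by have := other_in ec (subsetP FW e eF'); rewrite inE => /andP[].
    by move: ec; rewrite !inE /other; case: ifP => _; rewrite ?eqxx ?orbT //; case: (t e == v).
  have [oxW xI] := HW x xC; have [_ yI] := HW y yC; have [_ zI] := HW z zC.
  rewrite -oxy in yI; rewrite -oyz -oxy in zI.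
  rewrite subUset !sub1set vW oxW -card_gt0 => /(_ isT).
  have -> : (0 < #|[set v; other s t x v]|)%N by apply/card_gt0P; exists v; rewrite !inE eqxx.
  move/(_ isT); have : (#|[set v; other s t x v]| <= 2)%N by rewrite cards2; case: eqP.
  have : (#|[set e in [:: x; y; z]]| <= #|F :&: inside s t [set v; other s t x v]|)%N.
    apply/subset_leq_card/subsetP => e; rewrite in_set in_setI !inE.
    move: xC yC zC; rewrite !in_setI => /andP[xF _] /andP[yF _] /andP[zF _].
    by move: xI yI zI; rewrite !inE => xI yI zI /or3P[] /eqP ->; apply/andP.
  rewrite -eC C3 => h1 h2 h3; clear - h1 h2 h3; lia.
move=> uS eC o12; set S := [:: e1; e2; e3] in uS eC.
have HC e : e \in S -> [/\ e \in cut s t [set v], e \in inside s t W & e \notin F0].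
  move=> eS; have : e \in [set e in S] by rewrite inE.
  rewrite -eC in_setI => /andP[eF' ec]; split => //; first exact: (subsetP FW).
  by move: ec; rewrite !inE; case: (s e == v); case: (t e == v); rewrite ?andbF.
have [e1c e1W e1F] : [/\ e1 \in cut s t [set v], e1 \in inside s t W & e1 \notin F0].
  by apply: HC; rewrite inE eqxx.
have [e2c e2W _] : [/\ e2 \in cut s t [set v], e2 \in inside s t W & e2 \notin F0].
  by apply: HC; rewrite !inE eqxx orbT.
have F0W : F0 \subset inside s t (W :\ v) by apply: subsetIr.
rewrite eF eC; apply: (two_spanning_split vW F0W uS).
- by move=> e /HC [ec eW _]; rewrite inE ec.
- by move=> e /HC [].
have cS : #|F :&: cut s t [set v]| = 3 by rewrite eC cardsE (card_uniqP uS).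
have Wvk : (#|W :\ v| < k)%N by rewrite cWv; clear - Wk W1; lia.
have cF0W : (#|e1 |: F0| + 2 = 2 * #|W :\ v|)%N.
  by rewrite cardsU1 e1F cWv; clear - cF cF0 cS W1; lia.
apply: IH => //.
  rewrite subUset sub1set inE eqxx !other_in //=.
  apply/subsetP => e eF0; have := subsetP F0W e eF0; rewrite !inE.
  by have -> : (e == e1) = false by apply: contraNF e1F => /eqP <-.
move=> Y YW Y0; set s' := (fun e => _); set t' := (fun e => _).
have YW' : Y \subset W := subset_trans YW WvW.
have F0Y : (#|F0 :&: inside s t Y| <= #|F :&: inside s t Y|)%N.
  by rewrite subset_leq_card // setSI // subsetIl.
(* The new edge counts for [Y] only if both its ends lie there. Then [Y] has at least two vertices
   and fewer than [W], so it is not tight and has room for one more edge. *)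
have sub : (e1 |: F0) :&: inside s' t' Y \subset
    if (other s t e1 v \in Y) && (other s t e2 v \in Y) then e1 |: (F0 :&: inside s t Y) else F0 :&: inside s t Y.
  apply/subsetP => e; rewrite in_setI in_setU1 [e \in inside _ _ _]inE /s' /t'.
  have [->|ee1] := eqVneq e e1; first by move=> /= H; rewrite H setU11.
  rewrite /= => /andP[eF0 /andP[sY tY]]; have eI : e \in F0 :&: inside s t Y by rewrite in_setI eF0 inE sY.
  by case: ifP; rewrite ?in_setU1 eI ?orbT.
have := subset_leq_card sub; have sFY := sF Y YW' Y0.
case: ifP => [/andP[o1 o2]|_] cY; last by clear - cY F0Y sFY; lia.
have Y2 : (1 < #|Y|)%N.
  by apply/card_gt1P; exists (other s t e1 v), (other s t e2 v).
have YltW : (#|Y| < #|W|)%N.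
  by have := subset_leq_card YW; rewrite cWv => h; clear - h W1; lia.
have := noX Y; rewrite YW' Y2 YltW /= => /eqP nY.
by move: cY; rewrite cardsU1; case: (e1 \notin _) => cY; clear - cY F0Y sFY nY; lia.
Qed.

(** [W] itself spans enough edges because all degrees are at least 4. Minimality of [X] makes any
    [2 * #|X| - 2] of its non-loop edges sparse, and the cut condition survives the contraction of
    [X], so induction applies. *)
Lemma two_spanning_cut4 s t F W : F \subset inside s t W -> W != set0 ->
  (forall Y, Y \subset W -> Y != set0 -> Y != W -> (4 <= #|F :&: cut s t Y|)%N) ->
  two_spanning s t F W.
Proof.
have [k] := ubnP #|W|; elim: k => // k IH in s t F W *; rewrite ltnS => Wk FW W0 c4.
have [W1|W1] := leqP #|W| 1.
  by exists set0, set0; rewrite !sub0set -setI_eq0 setI0; split=> //; apply: spans_card1.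
(* Loops are dropped, as sparsity on singletons demands. *)
pose F0 := [set e in F | s e != t e].
have F0F : F0 \subset F by apply/subsetP => e; rewrite inE => /andP[].
have F0_2W : (2 * #|W| <= #|F0|)%N.
  have := sum_card_cut s t F0 W.
  have : (\sum_(v in W) 4 <= \sum_(v in W) #|F0 :&: cut s t [set v]|)%N.
    apply: leq_sum => v vW; apply: leq_trans (c4 [set v] _ _ _) _; rewrite ?sub1set //.
    - by apply/set0Pn; exists v; rewrite inE.
    - by apply: contraTneq W1 => <-; rewrite cards1.
    - apply/subset_leq_card/subsetP => e; rewrite !inE => /andP[-> /=].
      by move=> ne; rewrite ne andbT; apply: contraNneq ne => ->.
  rewrite sum_nat_const; lia.
pose P X := [&& X \subset W, (1 < #|X|)%N & (2 * #|X| <= #|F0 :&: inside s t X| + 2)%N].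
have PW : P W.
  rewrite /P subxx W1 (setIidPl (subset_trans F0F FW)); lia.
have [X /minsetP [/and3P[XW X1 XF] Xmin] _] := minset_exists PW.
have [F1 F1X cF1] : exists2 F1 : {set E}, F1 \subset F0 :&: inside s t X & #|F1| = (2 * #|X| - 2)%N.
  by apply: exists_subset_card; lia.
have F1I : F1 \subset inside s t X by apply: subset_trans F1X (subsetIr _ _).
have /card_gt0P [x0 x0X] : (0 < #|X|)%N by lia.
have F1F : F1 \subset F by apply: subset_trans F1X (subset_trans (subsetIl _ _) F0F).
apply: (@two_spanning_sub _ _ (F1 :|: (F :\: inside s t X))).
  by rewrite subUset F1F subsetDl.
apply: (two_spanning_contract (x0 := x0) XW) => //.
- exact: setSD.
- apply: two_spanning_sparse => //; [by apply/set0Pn; exists x0 | by clear - cF1 X1; lia |].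
  move=> Y YX Y0; have [Y1|Y1] := leqP #|Y| 1.
    suff -> : F1 :&: inside s t Y = set0 by rewrite cards0; rewrite -card_gt0 in Y0; clear - Y0; lia.
    have /eqP/cards1P [y ->] : #|Y| = 1 by rewrite -card_gt0 in Y0; clear - Y0 Y1; lia.
    apply/setP => e; rewrite !inE; apply/negP => /and3P[/(subsetP F1X)].
    by rewrite !inE => /andP[/andP[_ H] _] /eqP sy /eqP ty; rewrite sy ty eqxx in H.
  have [/eqP YX'|YX'] := boolP (Y == X).
    have := subset_leq_card (subsetIl F1 (inside s t Y)); rewrite YX' cF1 => h; clear - h X1; lia.
  have : ~~ P Y by apply: contra YX' => PY; rewrite (Xmin Y).
  rewrite /P (subset_trans YX XW) Y1 /= -ltnNge => H.
  have F1Y : (#|F1 :&: inside s t Y| <= #|F0 :&: inside s t Y|)%N.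
    by rewrite subset_leq_card // setSI // (subset_trans F1X) // subsetIl.
  clear - F1Y H; lia.
apply: IH.
- by rewrite cardsU1 !inE x0X /= cardsDS //; lia.
- apply/subsetP => e /setDP[eF _]; have := subsetP FW e eF.
  by rewrite inE [e \in inside _ _ _]inE => /andP[sW tW]; rewrite !contract_in.
- by apply/set0Pn; exists x0; rewrite setU11.
move=> Y YW' Y0 YnW.
(* A cut of the contracted graph is the cut of a preimage, and no edge inside [X] takes part in
   it. *)
pose Z := [set v in W | contract X x0 v \in Y].
have cW v : v \in x0 |: (W :\: X) -> v \in W /\ contract X x0 v = v.
  rewrite !inE /contract => /orP[/eqP ->|/andP[/negPf -> ->] //].
  by rewrite x0X (subsetP XW).
apply: leq_trans (c4 Z _ _ _) _.
- by apply/subsetP => v; rewrite inE => /andP[].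
- have [y yY] := set0Pn _ Y0; apply/set0Pn; exists y.
  by have [yW yE] := cW y (subsetP YW' y yY); rewrite inE yW yE.
- apply: contraNneq YnW => ZW; rewrite eqEsubset YW'; apply/subsetP => v vW.
  by have [v1 v2] := cW v vW; move: v1; rewrite -{1}ZW inE v2 => /andP[].
apply/subset_leq_card/subsetP => e; rewrite !in_setI => /andP[eF]; rewrite in_setD eF andbT.
have := subsetP FW e eF; rewrite !inE /= => /andP[-> ->] /= H; rewrite H andbT.
by apply: contra H => /andP[sX tX]; rewrite /contract sX tX.
Qed.

End TreePacking.

(** * Counting flows with restricted support *)

Section Counting.
Variables (V E : finType) (s t : E -> V).

Definition flows_in (A : finZmodType) (S : {set E}) : {set {ffun E -> A}} :=
  [set phi : {ffun E -> A} | [forall v, bnd s t phi v == 0] & [forall e, (e \notin S) ==> (phi e == 0)]].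

Lemma flows_inP (A : finZmodType) (S : {set E}) (phi : {ffun E -> A}) :
  reflect ((forall v, bnd s t phi v = 0) /\ (forall e, e \notin S -> phi e = 0)) (phi \in flows_in A S).
Proof.
rewrite inE; apply: (iffP andP) => [[/forallP H1 /forallP H2]|[H1 H2]].
  by split=> [v|e eS]; apply/eqP; [apply: H1 | apply: (implyP (H2 e))].
by split; apply/forallP => x; [rewrite H1 | apply/implyP => /H2 ->].
Qed.

Lemma leq_card_fibers (T U : finType) (D : {pred T}) (B : {pred U}) (f : T -> U) k :
  (forall x, x \in D -> f x \in B) ->
  (forall x, x \in D -> #|[pred y in D | f y == f x]| <= k)%N ->
  (#|D| <= #|B| * k)%N.
Proof.
move=> fB fk; rewrite -sum1_card (partition_big f (mem B)) //= -sum_nat_const.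
apply: leq_sum => b bB; rewrite sum1_card.
have [/existsP [x /andP[xD /eqP <-]]|] := boolP [exists x, (x \in D) && (f x == b)].
  exact: fk.
rewrite negb_exists => /forallP H; rewrite eq_card0 // => x.
by rewrite [LHS](negPf (H x)).
Qed.

(** Functions supported on [S] are sorted by their boundary away from [v0]. There are at most
    [#|A| ^ (#|V| - 1)] classes, and members of one class differ by a flow. *)
Lemma card_flows_in (A : finZmodType) (S : {set E}) (v0 : V) :
  (#|A| ^ #|S| <= #|A| ^ (#|V| - 1) * #|flows_in A S|)%N.
Proof.
have <- : #|pffun_on (0 : A) (mem S) (mem [set: A])| = (#|A| ^ #|S|)%N.
  by rewrite card_pffun_on cardsT.
have <- : #|pffun_on (0 : A) (mem [set~ v0]) (mem [set: A])| = (#|A| ^ (#|V| - 1))%N.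
  by rewrite card_pffun_on cardsT cardsC1 subn1.
(* The boundary at [v0] is determined by the others, so it is replaced by 0; hence the [- 1] in the
   exponent. *)
pose f (phi : {ffun E -> A}) := [ffun v => if v == v0 then 0 else bnd s t phi v].
apply: (@leq_card_fibers _ _ _ _ f) => [phi _|phi /pffun_onP [/supportP phiS _]].
  apply/pffun_onP; split; last by move=> x _; rewrite inE.
  by apply/supportP => v; rewrite !inE negbK ffunE => ->.
pose g (psi : {ffun E -> A}) : {ffun E -> A} := [ffun e => psi e - phi e].
have ginj : injective g.
  by move=> x y /ffunP gxy; apply/ffunP => e; have := gxy e; rewrite !ffunE => /addIr.
rewrite -(card_imset _ ginj); apply/subset_leq_card/subsetP => _ /imsetP [psi H ->].
case/andP: H => /pffun_onP [/supportP psiS _] /eqP /ffunP fE.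
have key v : v != v0 -> bnd s t (g psi) v = 0.
  move=> vv0; have := fE v; rewrite !ffunE (negPf vv0) => eqb.
  have -> : bnd s t (g psi) v = bnd s t (fun e => psi e - phi e) v by apply: eq_bnd => e; rewrite ffunE.
  by rewrite bndB eqb subrr.
apply/flows_inP; split => [v|e eS]; last by rewrite ffunE psiS // phiS // subrr.
have [->|] := eqVneq v v0; last exact: key.
have := sum_bnd_cut (s := s) (t := t) (phi := g psi) (X := setT).
rewrite (bigD1 v0) //= big1 ?addr0; first by apply=> e _; rewrite !inE.
by move=> v' /andP[_ vv0]; apply: key.
Qed.

(** Values prescribed off [T] leave a boundary with zero sum, which [T] can cancel. *)
Lemma spans_flow (A : zmodType) (T : {set E}) (f : E -> A) : spans s t T setT ->
  exists phi : E -> A, (forall v, bnd s t phi v = 0) /\ (forall e, e \notin T -> phi e = f e).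
Proof.
move=> sT; pose f' e := if e \in T then 0 else f e.
have [||psi [psiT psib]] := spans_realize (b := fun v => - bnd s t f' v) sT.
- by apply/subsetP => e _; rewrite !inE.
- by rewrite sumrN sum_bnd_cut ?oppr0 // => e _; rewrite !inE.
exists (fun e => f' e + psi e); split=> [v|e eT]; first by rewrite bndD psib ?inE // subrr.
by rewrite /f' (negPf eT) psiT // addr0.
Qed.

End Counting.

(** * Flows over Z_2 and Z_2 x Z_2 *)

Lemma Z2P (x : 'Z_2) : x = 0 \/ x = 1.
Proof. by case: x => [[|[|]]] //= i; [left|right]; apply/val_inj. Qed.

Lemma Z2_addxx (x : 'Z_2) : x + x = 0.
Proof. by case: (Z2P x) => ->; apply/val_inj. Qed.

Section Klein.
Variables (V E : finType) (s t : E -> V).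
Local Notation K := ('Z_2 * 'Z_2)%type.

Definition nz_flow_set (A : finZmodType) : {set {ffun E -> A}} :=
  [set phi : {ffun E -> A} | [forall v, bnd s t phi v == 0] & [forall e, phi e != 0]].

Lemma bnd_pair (A B : zmodType) (f : E -> A) (g : E -> B) v :
  bnd s t (fun e => (f e, g e)) v = (bnd s t f v, bnd s t g v).
Proof.
rewrite [LHS]surjective_pairing; congr (_, _).
  by rewrite -(bnd_morph _ _ _ (f := fst)) // => -[] ? ? [].
by rewrite -(bnd_morph _ _ _ (f := snd)) // => -[] ? ? [].
Qed.

(** The first coordinate is 1 off [T1], the second is 1 off [T2], and no edge lies in both. *)
Lemma Klein_flow : two_spanning s t [set: E] [set: V] -> (0 < #|nz_flow_set K|)%N.
Proof.
case=> T1 [T2 [_ _ dT s1 s2]].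
have [f [fb fT]] := spans_flow (fun=> 1 : 'Z_2) s1.
have [g [gb gT]] := spans_flow (fun=> 1 : 'Z_2) s2.
apply/card_gt0P; exists [ffun e => (f e, g e)]; rewrite inE.
apply/andP; split; [apply/forallP => v | apply/forallP => e].
  have -> : bnd s t [ffun e => (f e, g e)] v = bnd s t (fun e => (f e, g e)) v.
    by apply: eq_bnd => e; rewrite ffunE.
  by rewrite bnd_pair fb gb.
rewrite ffunE; have [eT1|eT1] := boolP (e \in T1).
  by rewrite (gT e) ?(disjointFr dT eT1) // xpair_eqE andbF.
by rewrite fT // xpair_eqE.
Qed.

(** Since [- d = d], adding [d] times a Z_2-flow can create zeros only where [phi] equals [d]; the
    flows vanishing there are counted by [card_flows_in]. *)
Lemma card_Klein_flows (v0 : V) (phi : {ffun E -> K}) : phi \in nz_flow_set K ->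
  exists z, (3 * z <= #|E|)%N /\ (2 ^ (#|E| - z) <= 2 ^ (#|V| - 1) * #|nz_flow_set K|)%N.
Proof.
rewrite inE => /andP[/forallP phib /forallP phi0].
pose a : K := (0, 1); pose b : K := (1, 0); pose c : K := (1, 1).
pose Z (d : K) := [set e | phi e == d].
(* The three nonzero values have disjoint preimages, so one of them is taken on at most a third of
   the edges. *)
have [d d0 Zd] : exists2 d : K, d != 0 & (3 * #|Z d| <= #|E|)%N.
  have : (#|Z a| + #|Z b| + #|Z c| <= #|E|)%N.
    have d1 : Z a :&: Z b = set0.
      by apply/setP => e; rewrite !inE; case: (phi e =P _) => // ->.
    have d2 : (Z a :|: Z b) :&: Z c = set0.
      by apply/setP => e; rewrite !inE; case: (phi e =P c) => [->|]; rewrite ?andbF.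
    have := cardsUI (Z a) (Z b); have := cardsUI (Z a :|: Z b) (Z c).
    rewrite d1 d2 cards0 !addn0 => h <-; rewrite -h; exact: max_card.
  move=> H; have [H1|H1] := leqP (3 * #|Z a|) #|E|; first by exists a.
  have [H2|H2] := leqP (3 * #|Z b|) #|E|; first by exists b.
  by exists c => //; lia.
exists #|Z d|; split=> //.
have := card_flows_in s t 'Z_2 (~: Z d) v0; rewrite card_ord /= cardsCs setCK.
move=> H; apply: (leq_trans H); rewrite leq_mul2l; apply/orP; right.
pose m (x : 'Z_2) : K := (x * d.1, x * d.2).
have m0 : m 0 = 0 by rewrite /m !mul0r.
have mD : {morph m : x y / x + y} by move=> x y; rewrite /m !mulrDl.
have m1 : m 1 = d by rewrite /m !mul1r; case: (d).
have minj x : (m x == 0) = (x == 0).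
  by case: (Z2P x) => ->; rewrite ?m0 ?eqxx // m1 (negPf d0).
pose g (h : {ffun E -> 'Z_2}) : {ffun E -> K} := [ffun e => phi e + m (h e)].
have ginj : injective g.
  move=> x y /ffunP gxy; apply/ffunP => e; have := gxy e; rewrite !ffunE => /addrI.
  by case: (Z2P (x e)) => ->; case: (Z2P (y e)) => ->;
    rewrite ?m0 ?m1 // => /eqP; rewrite ?(negPf d0) // eq_sym (negPf d0).
rewrite -(card_imset _ ginj); apply/subset_leq_card/subsetP => _ /imsetP [h /flows_inP [hb hZ] ->].
rewrite inE; apply/andP; split; [apply/forallP => v | apply/forallP => e].
  have -> : bnd s t (g h) v = bnd s t (fun e => phi e + (m \o h) e) v by apply: eq_bnd => e; rewrite ffunE.
  by rewrite bndD (eqP (phib v)) bnd_morph // hb m0 addr0.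
rewrite ffunE; have [eZ|eZ] := boolP (e \in Z d).
  by rewrite hZ ?m0 ?addr0 // inE negbK.
case: (Z2P (h e)) => ->; rewrite ?m0 ?addr0 // m1 addr_eq0.
apply: contra eZ => /eqP eq; rewrite inE eq eq_sym -addr_eq0 -m1 -mD.
by rewrite Z2_addxx m0.
Qed.

End Klein.

(** * Even subgraphs and Seymour's extension step *)

Lemma add1_neq (R : nzRingType) (x : R) : x + 1 != x.
Proof. by rewrite -subr_eq0 addrAC subrr add0r oner_neq0. Qed.

Lemma sub1_neq (R : nzRingType) (x : R) : x - 1 != x.
Proof. by rewrite -subr_eq0 addrAC subrr add0r oppr_eq0 oner_neq0. Qed.

(* c1 has two admissible values, and they give different values of c2. *)
Lemma two_edges_balance (R : comNzRingType) (a1 a2 d : R) (o1 o2 : bool) : 2 != 0 :> R ->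
  exists c1 c2 : R, [/\ c1 != a1, c2 != a2 & (-1) ^+ o1 * c1 + (-1) ^+ o2 * c2 = d].
Proof.
move=> R2; pose c2 c1 := (-1) ^+ o2 * (d - (-1) ^+ o1 * c1).
have c2E c1 : (-1) ^+ o1 * c1 + (-1) ^+ o2 * c2 c1 = d.
  by rewrite /c2 mulrA -expr2 sqrr_sign mul1r addrC subrK.
have [H|H] := eqVneq (c2 (a1 + 1)) a2; last first.
  by exists (a1 + 1), (c2 (a1 + 1)); rewrite add1_neq.
exists (a1 - 1), (c2 (a1 - 1)); rewrite sub1_neq; split => //.
rewrite -H -subr_eq0 /c2 -mulrBr.
have -> : d - (-1) ^+ o1 * (a1 - 1) - (d - (-1) ^+ o1 * (a1 + 1)) = (-1) ^+ o1 * 2 by ring.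
by rewrite mulrA -signr_addb mulr_sign; case: ifP; rewrite ?oppr_eq0.
Qed.

Section EvenSubgraphs.
Variables (V E : finType) (s t : E -> V).
Implicit Types (X Y W U : {set V}) (C S : {set E}).

(** Augmenting paths in the graph induced on [X], with unit capacity in both directions of each
    edge. If no augmenting path exists, the set reachable from [x] has a saturated cut of exactly
    [k] edges, one fewer than assumed. *)
Lemma menger X x y k : x \in X -> y \in X ->
  (forall Y, Y \subset X -> x \in Y -> y \notin Y -> (k <= #|inside s t X :&: cut s t Y|)%N) ->
  exists g : E -> int,
    [/\ forall v, bnd s t g v = ((v == x)%:R - (v == y)%:R) *+ k,
        forall e, e \notin inside s t X -> g e = 0 &
        forall e, -1 <= g e <= 1].
Proof.
move=> xX yX; elim: k => [|k IH] cutk.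
  by exists (fun=> 0); split=> // v; rewrite bnd0 mulr0n.
have [Y YX xY yY|g [gb gX g1]] := IH; first exact: ltnW (cutk Y YX xY yY).
pose p e := (e \in inside s t X) && (g e < 1).
pose q e := (e \in inside s t X) && (-1 < g e).
have [/path_flow [h [hb hpq]]|nxy] := boolP (connect (residual s t p q) x y).
  exists (fun e => g e + h e); split=> [v|e eX|e].
  - by rewrite bndD gb hb mulrSr.
  - by rewrite gX // add0r; have := hpq e; rewrite /p /q (negPf eX) /= !andbF !orbF => /eqP.
  - have := g1 e; case/or3P: (hpq e) => [/eqP ->|/andP[/eqP -> /andP[_ H]]|/andP[/eqP -> /andP[_ H]]];
      [by rewrite addr0 | clear - H; lia | clear - H; lia].
pose Y := [set v in X | connect (residual s t p q) x v].
have YX : Y \subset X by apply/subsetP => v; rewrite inE => /andP[].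
have xY : x \in Y by rewrite inE xX connect0.
have yY : y \notin Y by rewrite inE negb_and nxy orbT.
have := cutk Y YX xY yY; suff -> : #|inside s t X :&: cut s t Y| = k by rewrite ltnn.
have reach u v e : e \in inside s t X -> (p e && (s e == u) && (t e == v)) || (q e && (t e == u) && (s e == v)) ->
    u \in Y -> v \in Y.
  rewrite inE => /andP[sX tX] H; rewrite !inE => /andP[_ xu].
  have vX : v \in X by case/orP: H => /andP[_ /eqP <-].
  rewrite vX (connect_trans xu) // connect1 //; apply/existsP; exists e.
  by rewrite !andbA.
(* The net outflow of [Y] is [k]; below, every cut edge is shown to carry one unit outwards. *)
have sumY : \sum_(v in Y) bnd s t g v = k%:R.
  rewrite (eq_bigr _ (fun v _ => gb v)) sumrMnl sumrB.
  rewrite (bigD1 x) //= eqxx big1 ?addr0; last by move=> v /andP[_ /negPf ->].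
  by rewrite big1 ?subr0 // => v vY; case: eqP vY yY => // -> ->.
apply/eqP; rewrite -(eqr_nat int) -sumY sum_bnd -sum1_card natr_sum; apply/eqP.
rewrite [in RHS]big_mkcond [X in _ - X]big_mkcond -sumrB [LHS]big_mkcond /=.
apply: eq_bigr => e _; rewrite in_setI.
have [eX|eX] := boolP (e \in inside s t X); last by rewrite gX // !if_same subrr.
rewrite [e \in cut _ _ _]inE /=.
have [sY|sY] := boolP (s e \in Y); have [tY|tY] := boolP (t e \in Y); rewrite ?subrr //=.
  have : ~~ p e by apply: contra tY => pe; apply: reach eX _ sY; rewrite pe !eqxx.
  by rewrite /p eX /= => H; have := g1 e; clear - H; lia.
have : ~~ q e by apply: contra sY => pe; apply: reach eX _ tY; rewrite pe !eqxx orbT.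
by rewrite /q eX /= => H; have := g1 e; clear - H; lia.
Qed.

(** All degrees are even, expressed by a Z_2-flow so that loops count twice. *)
Definition even_subgraph C := forall v, bnd s t (fun e => (e \in C)%:R : 'Z_2) v = 0.

Lemma sign_Z2 (z : int) : -1 <= z <= 1 -> z%:~R = (z != 0)%:R :> 'Z_2.
Proof.
move=> z1; have [->|[->|->]] : z = 0 \/ z = 1 \/ z = -1 by lia.
- by [].
- by [].
- exact/val_inj.
Qed.

Lemma bnd_intr (A : pzRingType) (g : E -> int) v :
  bnd s t (fun e => (g e)%:~R : A) v = (bnd s t g v)%:~R.
Proof. by rewrite -(bnd_morph _ _ _ (f := fun z : int => z%:~R : A)) // => x y; rewrite intrD. Qed.

(** Two units of flow from [x] to [y] have, modulo 2, an even support, of which the component of [x]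
    is kept. No support edge leaves that component, so its net outflow is zero and it must contain
    [y]. *)
Lemma even_connected X x y : x \in X -> y \in X ->
  (forall Y, Y \subset X -> x \in Y -> y \notin Y -> (2 <= #|inside s t X :&: cut s t Y|)%N) ->
  exists W C, [/\ W \subset X, (x \in W) && (y \in W), C \subset inside s t W, even_subgraph C & spans s t C W].
Proof.
move=> xX yX /(menger xX yX) [g [gb gX g1]].
pose r := residual s t (fun e => g e != 0) (fun e => g e != 0).
pose K := [set v | connect r x v].
have rstep e : g e != 0 -> r (s e) (t e) /\ r (t e) (s e).
  by move=> ge; split; apply/existsP; exists e; rewrite ge !eqxx ?orbT.
have Kcl e : g e != 0 -> (s e \in K) = (t e \in K).
  move=> /rstep [r1 r2]; rewrite !inE; apply/idP/idP => H; apply: connect_trans H _; exact: connect1.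
have gI e : g e != 0 -> e \in inside s t X by apply: contraNT => /gX ->.
have xK : x \in K by rewrite inE connect0.
have KX : K \subset X.
  apply/subsetP => v; rewrite inE => xv.
  have cl : closed r (mem X).
    by move=> a b /existsP [e]; rewrite /= => /orP[] /and3P[/gI + /eqP <- /eqP <-]; rewrite inE => /andP[-> ->].
  by rewrite -(closed_connect cl xv).
have yK : y \in K.
  apply/contraT => yK.
  have H e : g e != 0 -> e \notin cut s t K by move=> ge; rewrite inE Kcl // eqxx.
  have := sum_bnd_cut H.
  rewrite (eq_bigr _ (fun v _ => gb v)) sumrMnl sumrB.
  rewrite (bigD1 x) //= eqxx big1 ?addr0; last by move=> v /andP[_ /negPf ->].
  by rewrite big1 ?subr0 // => v vY; case: eqP vY yK => // -> ->.
pose C := [set e | (g e != 0) && (s e \in K)].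
exists K, C; split => //; first by rewrite xK.
- apply/subsetP => e; rewrite in_set => /andP[ge sK].
  by rewrite [_ \in inside _ _ _]in_set -Kcl // sK.
- move=> v; have [vK|vK] := boolP (v \in K); last first.
    rewrite bnd_eq0 // => e; have [|_] := boolP (e \in C); last by rewrite eqxx.
    rewrite in_set => /andP[ge sK] _; split; first by apply: contraNneq vK => <-.
    by rewrite Kcl // in sK; apply: contraNneq vK => <-.
  rewrite (@eq_bnd_at _ _ _ _ _ _ (fun e => (g e)%:~R)).
    by rewrite bnd_intr gb mulr2n intrD Z2_addxx.
  move=> e ev; rewrite sign_Z2 // in_set; case: (eqVneq (g e) 0) => //= ge.
  by case: ev => ev; [rewrite ev vK | rewrite Kcl // ev vK].
move=> Y YK Y0 YnK.
have [/exists_inP [e eC eY]|] := boolP [exists e in C, e \in cut s t Y]; first by exists e.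
rewrite negb_exists_in => /forall_inP noC.
have cl : closed r (mem Y).
  have He e : g e != 0 -> (s e \in Y) = (t e \in Y).
    move=> ge; have [sK|sK] := boolP (s e \in K).
      have eC : e \in C by rewrite in_set ge.
      by have := noC e eC; rewrite inE negbK => /eqP.
    have tK := sK; rewrite Kcl // in tK.
    by rewrite (contraNF (subsetP YK _) sK) (contraNF (subsetP YK _) tK).
  by move=> a b /existsP [e] /= /orP[] /and3P[/He + /eqP <- /eqP <-].
have all v : v \in K -> (v \in Y) = (x \in Y).
  by rewrite inE => /(closed_connect cl) <-.
have [w wY] := set0Pn _ Y0; case/negP: YnK; rewrite eqEsubset YK; apply/subsetP => v vK.
by rewrite all // -(all w) ?(subsetP YK).
Qed.

(** Oriented cycles are peeled off [C] one at a time. They are edge-disjoint, so their sum takes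
    only the values 1 and -1 on [C]. *)
Lemma even_circulation C : even_subgraph C -> exists psi : E -> int,
  [/\ forall v, bnd s t psi v = 0, forall e, -1 <= psi e <= 1 &
      forall e, (psi e != 0) = (e \in C)].
Proof.
have [k] := ubnP #|C|; elim: k => // k IH in C *; rewrite ltnS => Ck evC.
have [->|/set0Pn [e0 e0C]] := eqVneq C set0.
  by exists (fun=> 0); split=> [v|e|e] //; rewrite ?bnd0 // inE eqxx.
pose C' := C :\ e0; pose r := residual s t (mem C') (mem C').
(* Parity: after removing [e0], only its ends can have odd degree, so they lie in one component. *)
have /path_flow [g [gb gpq]] : connect r (t e0) (s e0).
  apply/contraT => nc; pose K := [set v | connect r (t e0) v].
  have tK : t e0 \in K by rewrite in_set connect0.
  have sK : s e0 \notin K by rewrite in_set.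
  have H e : (e \in C')%:R != 0 :> 'Z_2 -> e \notin cut s t K.
    have [eC _|] := boolP (e \in C'); last by rewrite eqxx.
    rewrite inE negbK; apply/eqP; rewrite !inE; apply/idP/idP => H; apply: connect_trans H _;
    apply: connect1; apply/existsP; exists e;
    by rewrite /= eC !eqxx ?orbT.
  have := sum_bnd_cut H.
  rewrite (eq_bigr (fun v => - (1 *+ (v == s e0) - 1 *+ (v == t e0)))) => [|v _]; last first.
    apply/eqP; rewrite -addr_eq0 -bnd_single -bndD -[X in _ == X](evC v); apply/eqP.
    apply: eq_bnd => e; rewrite in_setD1.
    by case: (e =P e0) => [->|_]; rewrite ?e0C ?add0r ?addr0.
  rewrite sumrN sumrB (bigD1 (t e0)) // [X in - (_ - X)](bigD1 (t e0)) //= eqxx.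
  rewrite big1 ?addr0; last by move=> v /andP[vK _]; case: eqP vK sK => // -> ->.
  rewrite big1 ?addr0; last by move=> v /andP[_ /negPf ->].
  by case: eqP tK sK => [-> ->|].
have ge0 : g e0 = 0.
  by have := gpq e0; rewrite /= !inE eqxx !andbF !orbF => /eqP.
pose h e := g e + (if e == e0 then 1 else 0).
have hb v : bnd s t h v = 0 by rewrite bndD gb bnd_single; ring.
have h1 e : -1 <= h e <= 1.
  rewrite /h; case: (e =P e0) => [->|_]; first by rewrite ge0.
  by case/or3P: (gpq e) => [/eqP ->|/andP[/eqP -> _]|/andP[/eqP -> _]].
have hC e : h e != 0 -> e \in C.
  rewrite /h; case: (e =P e0) => [->|_] //; rewrite addr0 => ge.
  by have := gpq e; rewrite (negPf ge) /= !inE => /orP[] /andP[_ /andP[]].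
pose C2 := [set e in C | h e == 0].
have [||psi [psib psi1 psiC]] := IH C2.
- apply: leq_trans Ck; apply: proper_card; apply/properP; split.
    by apply/subsetP => e; rewrite inE => /andP[].
  by exists e0; rewrite // inE e0C /h ge0 eqxx.
- move=> v; rewrite (@eq_bnd _ _ _ _ _ _ (fun e => (e \in C)%:R - (h e)%:~R)).
    by rewrite bndB evC bnd_intr hb subrr.
  move=> e; rewrite sign_Z2 // inE; case: (eqVneq (h e) 0) => [_|/hC ->]; last by rewrite subrr.
  by rewrite andbT subr0.
exists (fun e => psi e + h e); split=> [v|e|e]; first by rewrite bndD psib hb addr0.
  have [->|he] := eqVneq (h e) 0; first by rewrite addr0.
  by have := psiC e; rewrite inE (negPf he) andbF => /negbFE/eqP ->; rewrite add0r.
have := psiC e; rewrite inE; have [->|he] := eqVneq (h e) 0; first by rewrite addr0 andbT.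
by rewrite andbF => /negbFE/eqP ->; rewrite add0r he hC.
Qed.

Variable A : comNzRingType.
Hypothesis two_neq0 : 2 != 0 :> A.

(** The invariant of Seymour's argument in group-connectivity form: off [S] one value per edge is
    forbidden, and every zero-sum boundary is attained. The freedom in [f] and [b] allows edges
    outside [U] to be fixed first. *)
Definition good U S := [/\ S \subset inside s t U, even_subgraph S &
  forall (f : E -> A) (b : V -> A), \sum_(v in U) b v = 0 ->
    exists phi : E -> A,
      [/\ forall e, e \notin inside s t U -> phi e = 0,
          forall v, v \in U -> bnd s t phi v = b v &
          forall e, e \in inside s t U -> e \notin S -> phi e != f e]].

Lemma good_singleton v : good [set v] set0.
Proof.
split=> [|w|f b]; first exact: sub0set.
  by apply: bnd_eq0 => e; rewrite inE eqxx.
rewrite big_set1 => bv; pose phi e : A := if e \in inside s t [set v] then f e + 1 else 0.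
have H e : phi e != 0 -> e \notin cut s t [set v].
  rewrite /phi; case: ifP; last by rewrite eqxx.
  by rewrite !inE => /andP[-> ->].
exists phi; split=> [e /negPf eI|w|e eI _]; first by rewrite /phi eI.
  by rewrite inE => /eqP ->; have := sum_bnd_cut H; rewrite big_set1 bv.
by rewrite /phi eI add1_neq.
Qed.

Lemma sum_bnd_single (B : zmodType) (k : B) e0 W :
  \sum_(v in W) bnd s t (fun e => if e == e0 then k else 0) v = k *+ (s e0 \in W) - k *+ (t e0 \in W).
Proof.
have aux (r : E -> V) : \sum_(e | r e \in W) (if e == e0 then k else 0) = k *+ (r e0 \in W).
  rewrite -big_mkcondr; have [rW|rW] := boolP (r e0 \in W).
    by rewrite (big_pred1 e0) // => e /=; case: (e =P e0) => [->|]; rewrite ?rW ?andbF.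
  by rewrite big_pred0 // => e; case: (e =P e0) => [->|]; rewrite ?andbF // (negPf rW).
by rewrite sum_bnd !aux.
Qed.

Lemma sum_setU_disjoint (B : zmodType) U W (b : V -> B) : [disjoint U & W] ->
  \sum_(v in U :|: W) b v = \sum_(v in U) b v + \sum_(v in W) b v.
Proof. by move=> UW; rewrite (big_setID U) /= setUK setDUl setDv set0U (setDidPl _) // disjoint_sym. Qed.

Definition between U W : {set E} := cut s t W :&: inside s t (U :|: W).

(** Values are fixed in stages. New edges off [C] get any allowed value, except [e1] and [e2], which
    give [W] its correct total boundary. Then the unrestricted edges of [C] correct each vertex of
    [W], and [good U S] absorbs the rest on [U]. *)
Lemma good_extend U S W C e1 e2 : good U S -> [disjoint U & W] -> C \subset inside s t W ->
  even_subgraph C -> spans s t C W -> e1 \in between U W -> e2 \in between U W -> e1 != e2 ->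
  good (U :|: W) (S :|: C).
Proof.
case=> SU evS goodU UW CW evC sC e1D e2D e12.
have nUW v : v \in W -> v \in U = false by move=> vW; rewrite (disjointFl UW).
have nWU v : v \in U -> v \in W = false by move=> vU; rewrite (disjointFr UW).
have IU e : e \in inside s t U -> e \notin inside s t W.
  by rewrite !inE => /andP[sU _]; rewrite nWU.
have DW e : e \in between U W -> e \notin inside s t W.
  by rewrite !inE => /andP[+ _]; apply: contra => /andP[-> ->].
have DU e : e \in between U W -> e \notin inside s t U.
  by rewrite !inE => /andP[+ _]; apply: contra => /andP[sU tU]; rewrite !nWU.
have tri e : e \in inside s t (U :|: W) ->
    [\/ e \in inside s t U, e \in inside s t W | e \in between U W].
  rewrite !inE; have [sU|sU] := boolP (s e \in U); have [tU|tU] := boolP (t e \in U).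
  - by constructor 1.
  - by rewrite /= => tW; constructor 3; rewrite tW nWU.
  - by rewrite /= andbT => sW; constructor 3; rewrite sW nWU.
  - by move=> sW; constructor 2.
have disj e : (e \in S) && (e \in C) = false.
  by apply/negP => /andP[/(subsetP SU)/IU eS /(subsetP CW)]; apply/negP.
split.
- rewrite subUset; apply/andP; split; apply/subsetP => e.
    by move/(subsetP SU); rewrite !inE => /andP[-> ->].
  by move/(subsetP CW); rewrite !inE => /andP[-> ->]; rewrite !orbT.
- move=> v; rewrite (@eq_bnd _ _ _ _ _ _ (fun e => (e \in S)%:R + (e \in C)%:R)).
    by rewrite bndD evS evC addr0.
  by move=> e; have := disj e; rewrite inE; case: (e \in S); case: (e \in C); rewrite ?addr0 ?add0r.
move=> f b b0.
pose f0 e : A := if (e \in inside s t (U :|: W)) && (e \notin inside s t U)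
    && (e \notin C) && (e != e1) && (e != e2) then f e + 1 else 0.
have [c1 [c2 [c1f c2f cE]]] := two_edges_balance (f e1) (f e2)
  (\sum_(v in W) b v - \sum_(v in W) bnd s t f0 v) (t e1 \in W) (t e2 \in W) two_neq0.
pose f1 e := f0 e + ((if e == e1 then c1 else 0) + (if e == e2 then c2 else 0)).
have sgn e (c : A) : e \in between U W -> c *+ (s e \in W) - c *+ (t e \in W) = (-1) ^+ (t e \in W) * c.
  rewrite in_setI => /andP[+ _]; rewrite inE.
  by case: (s e \in W); case: (t e \in W) => //= _; rewrite ?expr0 ?expr1 ?subr0 ?sub0r ?mul1r ?mulN1r.
have f1W : \sum_(v in W) bnd s t f1 v = \sum_(v in W) b v.
  have f1E v : bnd s t f1 v = bnd s t f0 v + bnd s t (fun e => if e == e1 then c1 else 0) v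
      + bnd s t (fun e => if e == e2 then c2 else 0) v by rewrite -addrA -!bndD.
  rewrite (eq_bigr _ (fun v _ => f1E v)) big_split /= sum_bnd_single big_split /= sum_bnd_single.
  by rewrite !sgn // -addrA cE addrC subrK.
have [|psi [psiC psib]] := spans_realize (b := fun v => b v - bnd s t f1 v) sC CW.
  by rewrite sumrB f1W subrr.
pose f2 e := f1 e + psi e.
have f2W v : v \in W -> bnd s t f2 v = b v by move=> vW; rewrite bndD psib // addrC subrK.
have ne e e' (c : A) : e \notin between U W -> e' \in between U W -> (if e == e' then c else 0) = 0.
  by move=> eD e'D; case: eqP eD => // ->; rewrite e'D.
have UWI e : e \in inside s t U -> e \in inside s t (U :|: W).
  by rewrite !inE => /andP[-> ->].
have WWI e : e \in inside s t W -> e \in inside s t (U :|: W).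
  by rewrite !inE => /andP[-> ->]; rewrite !orbT.
have f2I e : e \notin inside s t (U :|: W) -> f2 e = 0.
  move=> eI; have eD : e \notin between U W by rewrite inE negb_and eI orbT.
  rewrite /f2 /f1 !ne // /f0 (negPf eI) /= psiC ?addr0 //.
  by apply: contra eI => /(subsetP CW)/WWI.
have f2U e : e \in inside s t U -> f2 e = 0.
  move=> eU; have eD : e \notin between U W by apply: contraL eU => /DU.
  rewrite /f2 /f1 !ne // /f0 eU andbF /= psiC ?addr0 //.
  by apply: contra (IU e eU) => /(subsetP CW).
(* The remaining demand on [U] sums to zero: [f2] and [b] both have total 0 over [U :|: W], and they
   agree on [W]. *)
have [|phi [phi0 phib phif]] := goodU f (fun v => b v - bnd s t f2 v).
  rewrite sumrB; have := sum_setU_disjoint b UW; have := sum_setU_disjoint (bnd s t f2) UW.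
  rewrite b0 (eq_bigr _ f2W) sum_bnd_cut => [e0 b1|e].
    by apply/eqP; rewrite subr_eq0; apply/eqP/(addIr (\sum_(v in W) b v)); rewrite -e0 -b1.
  by apply: contraNN => eI; rewrite f2I //; move: eI; rewrite !inE => + ; case: (_ || _); case: (_ || _).
exists (fun e => f2 e + phi e); split=> [e eI|v vUW|e eI].
- by rewrite f2I // phi0 ?addr0 //; apply: contra eI => /UWI.
- rewrite bndD; have [vU|vU] := boolP (v \in U); first by rewrite phib // addrC subrK.
  have vW : v \in W by move: vUW; rewrite inE (negPf vU).
  rewrite f2W // bnd_eq0 ?addr0 // => e pe.
  have : e \in inside s t U by apply: contraNT pe => /phi0 ->.
  by rewrite inE => /andP[sU tU]; split; apply: contraNneq vU => <-.
rewrite inE negb_or => /andP[eS eC]; case: (tri e eI) => [eU|eW|eD].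
- by rewrite f2U // add0r phif.
- have eU : e \notin inside s t U by apply: contraL eW => /IU.
  have eD : e \notin between U W by apply: contraL eW => /DW.
  rewrite phi0 // addr0 /f2 /f1 psiC // !ne // !addr0 /f0 eI eU eC /=.
  have -> /= : e != e1 by apply: contraNneq eD => ->.
  have -> /= : e != e2 by apply: contraNneq eD => ->.
  exact: add1_neq.
rewrite phi0 ?DU // addr0 /f2 psiC // addr0 /f1 /f0 eI DU // eC /=.
have [->|ee1] := eqVneq e e1; first by rewrite (negPf e12) /= add0r addr0.
have [->|ee2] := eqVneq e e2; first by rewrite /= !add0r.
by rewrite /= !addr0 add1_neq.
Qed.

End EvenSubgraphs.

(** * Growing a good set to all vertices *)

Section Growth.
Variables (V E : finType) (s t : E -> V).
Implicit Types (X Y W U : {set V}) (C S : {set E}).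
Variable A : comNzRingType.
Hypothesis two_neq0 : 2 != 0 :> A.
Hypothesis cut3 : forall Y, Y != set0 -> Y != setT -> (3 <= #|cut s t Y|)%N.

(** [X] is a minimal nonempty subset of the complement [Z] joined to the rest of [Z] by at most one
    edge. Its cut has at least three edges, so two of them go to [U], and minimality makes their
    ends in [X] satisfy [even_connected]. *)
Lemma good_grow U S : U != set0 -> U != setT -> good s t A U S ->
  exists U' S', good s t A U' S' /\ U \proper U'.
Proof.
move=> U0 UT goodU; pose Z := ~: U.
pose P X := [&& X != set0, X \subset Z & (#|cut s t X :&: inside s t Z| <= 1)%N].
have PZ : P Z.
  apply/and3P; split=> //.
    by apply: contraNneq UT => Z0; rewrite -(setCK U) -/Z Z0 setC0.
  suff -> : cut s t Z :&: inside s t Z = set0 by rewrite cards0.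
  by apply/setP => e; rewrite in_setI ![e \in _]inE; case: (s e \in Z); case: (t e \in Z).
have [X /minsetP [/and3P[X0 XZ cX] Xmin] _] := minset_exists PZ.
have inZ v : v \in X -> v \notin U by move/(subsetP XZ); rewrite inE.
have XT : X != setT.
  have [u uU] := set0Pn _ U0; apply: contraTneq (uU) => XT; apply: inZ; by rewrite XT inE.
have c2 : (1 < #|cut s t X :\: inside s t Z|)%N.
  by have := cut3 X0 XT; rewrite -(cardsID (inside s t Z)) => h; clear - h cX; lia.
have /card_gt1P [e1 [e2 [e1c e2c e12]]] := c2.
pose o e := if s e \in X then s e else t e.
have oX e : e \in cut s t X :\: inside s t Z -> o e \in X.
  by rewrite in_setD => /andP[_]; rewrite inE /o; case: ifP => // _; case: (t e \in X).
have [|W [C [WX /andP[xW yW] CW evC sC]]] := even_connected (s := s) (t := t) (oX _ e1c) (oX _ e2c).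
  (* By minimality [Y] and [X :\: Y] each have at least two cut edges within [Z], but at most one
     edge leaves [X] within [Z]. So for one of the two sides, all these cut edges run between [Y]
     and [X :\: Y]. *)
  move=> Y YX xY yY; set x := o e1 in xY; set y := o e2 in yY.
  have big Y' : Y' \subset X -> Y' != set0 -> Y' != X -> (1 < #|cut s t Y' :&: inside s t Z|)%N.
    move=> YX' Y0 YnX; rewrite ltnNge; apply: contra YnX => cY; apply/eqP/Xmin => //.
    by rewrite /P Y0 (subset_trans YX' XZ).
  have bY : (1 < #|cut s t Y :&: inside s t Z|)%N.
    apply: big => //; first by apply/set0Pn; exists x.
    by apply: contraNneq yY => ->; apply: oX.
  have bX : (1 < #|cut s t (X :\: Y) :&: inside s t Z|)%N.
    apply: big; first exact: subsetDl.
      by apply/set0Pn; exists y; rewrite inE yY oX.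
    by apply: contraTneq xY => XY; have := oX _ e1c; rewrite -{1}XY inE => /andP[].
  set a := inside s t X :&: cut s t Y.
  set p := cut s t Y :&: cut s t X :&: inside s t Z.
  set q := cut s t (X :\: Y) :&: cut s t X :&: inside s t Z.
  have sub v : v \in Y -> v \in X := subsetP YX v.
  have h1 : (#|cut s t Y :&: inside s t Z| <= #|a :|: p|)%N.
    apply/subset_leq_card/subsetP => e; have := sub (s e); have := sub (t e).
    rewrite !inE; case: (s e \in Y); case: (t e \in Y) => //=.
      by move=> _ /(_ isT) -> ->; case: (t e \in X).
    by move=> /(_ isT) -> _ ->; case: (s e \in X).
  have h2 : (#|cut s t (X :\: Y) :&: inside s t Z| <= #|a :|: q|)%N.
    apply/subset_leq_card/subsetP => e; have := sub (s e); have := sub (t e).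
    by rewrite !inE; case: (s e \in Y); case: (t e \in Y); case: (s e \in X); case: (t e \in X) => //= + + ->.
  have h3 : (#|p :|: q| <= #|cut s t X :&: inside s t Z|)%N.
    by apply/subset_leq_card/subsetP => e; rewrite !inE; case/orP=> /andP[/andP[_ ->] ->].
  have h4 : p :&: q = set0.
    apply/setP => e; have := sub (s e); have := sub (t e); rewrite !inE.
    case: (s e \in Y); case: (t e \in Y); case: (s e \in X); case: (t e \in X) => //=;
    by rewrite ?andbF // => + /(_ isT) || move=> /(_ isT).
  have := cardsUI p q; rewrite h4 cards0 => h5.
  have := cardsU a p; have := cardsU a q => h6 h7.
  clear - bY bX h1 h2 h3 h5 h6 h7 cX; lia.
have UW : [disjoint U & W].
  rewrite disjoint_sym; apply/pred0P => v /=; apply/negP => /andP[vW vU].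
  by have := inZ v (subsetP WX v vW); rewrite vU.
have betw e : e \in cut s t X :\: inside s t Z -> o e \in W -> e \in between s t U W.
  rewrite in_setD => /andP[eZ eX] oW; rewrite in_setI [e \in cut _ _ W]inE [e \in inside _ _ _]inE !inE.
  have nX v : v \notin X -> v \in W = false by apply: contraNF => /(subsetP WX).
  move: eZ eX oW; rewrite !inE /o negb_and !negbK.
  have [sX|sX] := boolP (s e \in X); have [tX|tX] := boolP (t e \in X) => //= + _ oW.
    by rewrite oW (negPf (inZ _ sX)) (nX _ tX) /= => ->.
  by rewrite oW (negPf (inZ _ tX)) (nX _ sX) /= orbF => ->; rewrite ?orbT.
exists (U :|: W), (S :|: C); split.
  exact: (good_extend two_neq0 goodU UW CW evC sC (betw _ e1c xW) (betw _ e2c yW) e12).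
apply/properP; split; first exact: subsetUl.
by exists (o e1); [rewrite inE xW orbT | exact: inZ (oX _ e1c)].
Qed.

(** Once the good set is everything, take boundary 0 and forbid the value 0. *)
Lemma seymour_decomposition (v0 : V) : exists2 S, even_subgraph s t S &
  exists phi : E -> A, (forall v, bnd s t phi v = 0) /\ (forall e, e \notin S -> phi e != 0).
Proof.
suff [S [_ evS goodS]] : exists S, good s t A setT S.
  exists S => //; have [|phi [_ phib phi0]] := goodS (fun=> 0) (fun=> 0); first exact: big1.
  by exists phi; split=> [v|e eS]; [rewrite phib ?inE | apply: phi0; rewrite ?inE].
have : exists S, good s t A [set v0] S by exists set0; apply: good_singleton.
have : [set v0] != set0 by apply/set0Pn; exists v0; rewrite inE.
move: [set v0] => U; have [k] := ubnP #|~: U|; elim: k => // k IH in U *.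
rewrite ltnS => Uk U0 [S goodU]; have [UT|UT] := eqVneq U setT; first by exists S; rewrite -UT.
have [U' [S' [goodU' UU']]] := good_grow U0 UT goodU.
apply: (IH U'); [| | by exists S'].
  by apply: leq_trans Uk; rewrite proper_card // properC.
by have [u uU] := set0Pn _ U0; apply/set0Pn; exists u; apply: (subsetP (proper_sub UU')).
Qed.

End Growth.

(** * Combining flows over Z_2 and Z_3 into flows over Z_6 *)

Definition emb2 (x : 'Z_2) : 'Z_6 := inZp (3 * x).
Definition emb3 (x : 'Z_3) : 'Z_6 := inZp (2 * x).

Lemma emb2D : {morph emb2 : x y / x + y}.
Proof. by case=> [[|[|]] //= i] [[|[|]] //= j]; apply/val_inj. Qed.

Lemma emb3D : {morph emb3 : x y / x + y}.
Proof. by case=> [[|[|[|]]] //= i] [[|[|[|]]] //= j]; apply/val_inj. Qed.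

(** The Chinese remainder theorem for 6, by inspection of the six cases. *)
Lemma emb_eq0 (x : 'Z_3) (y : 'Z_2) : emb3 x + emb2 y = 0 -> x = 0 /\ y = 0.
Proof.
case: x => [[|[|[|]]] //= i]; case: y => [[|[|]] //= j] => /(congr1 val) //= _.
by split; apply/val_inj.
Qed.

Lemma emb_inj (x x' : 'Z_3) (y y' : 'Z_2) :
  emb3 x + emb2 y = emb3 x' + emb2 y' -> x = x' /\ y = y'.
Proof.
move=> eq; have [|/eqP + /eqP] := @emb_eq0 (x - x') (y - y').
  apply: (addIr (emb3 x' + emb2 y')).
  by rewrite add0r addrACA -emb3D -emb2D !subrK.
by rewrite !subr_eq0 => /eqP -> /eqP ->.
Qed.

Section SixFlows.
Variables (V E : finType) (s t : E -> V).

Lemma card_pairs (T U : finType) (P : {set T}) (Q : T -> {set U}) :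
  #|[set p : T * U | (p.1 \in P) && (p.2 \in Q p.1)]| = (\sum_(x in P) #|Q x|)%N.
Proof.
rewrite -sum1_card (eq_bigl (fun p : T * U => (p.1 \in P) && (p.2 \in Q p.1))); last by move=> p; rewrite inE.
rewrite -(pair_big_dep (fun x => x \in P) (fun x y => y \in Q x) (fun _ _ => 1%N)) /=.
by apply: eq_bigr => x _; rewrite sum1_card.
Qed.

(** Here [k] is the size of the even subgraph and [g] the number of Z_3-modifications with few
    zeros. Each is paired with the Z_2-flows vanishing on its zeros, and distinct pairs give
    distinct Z_6-flows. *)
Lemma card_six_flows (v0 : V) :
  (forall Y, Y != set0 -> Y != setT -> (3 <= #|cut s t Y|)%N) ->
  exists g k, [/\ (k <= #|E|)%N, (0 < g)%N, (3 ^ k <= g * 3 ^ #|V|)%N &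
    (g * 2 ^ (#|E| - k %/ 3) <= 2 ^ (#|V| - 1) * #|nz_flow_set s t 'Z_6|)%N].
Proof.
move=> cut3; have two_neq0 : 2 != 0 :> 'Z_3 by [].
have [S evS [phi3 [phib phi0]]] := seymour_decomposition two_neq0 cut3 v0.
have [psi [psib psi1 psiS]] := even_circulation evS.
pose psi3 e : 'Z_3 := (psi e)%:~R.
have psi3b v : bnd s t psi3 v = 0 by rewrite bnd_intr psib.
have psi3S e : (psi3 e != 0) = (e \in S).
  rewrite -psiS /psi3; have [->|[->|->]] : psi e = 0 \/ psi e = 1 \/ psi e = -1.
    by have := psi1 e; clear; lia.
  - by rewrite !eqxx.
  - by [].
  - by [].
pose Z (h : E -> 'Z_3) := [set e | phi3 e + h e == 0].
pose G := [set h in flows_in s t 'Z_3 S | (3 * #|Z h| <= #|S|)%N].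
have ZS h : h \in flows_in s t 'Z_3 S -> Z h \subset S.
  move=> /flows_inP [_ hS]; apply/subsetP => e; rewrite inE; apply: contraTT => eS.
  by rewrite hS // addr0 phi0.
pose shift (c : 'Z_3) (h : {ffun E -> 'Z_3}) : {ffun E -> 'Z_3} := [ffun e => h e + c * psi3 e].
have shiftH c h : h \in flows_in s t 'Z_3 S -> shift c h \in flows_in s t 'Z_3 S.
  move=> /flows_inP [hb hS]; apply/flows_inP; split=> [v|e eS].
    have -> : bnd s t (shift c h) v = bnd s t (fun e => h e + ( *%R c \o psi3) e) v.
      by apply: eq_bnd => e; rewrite ffunE.
    by rewrite bndD hb bnd_morph ?psi3b ?mulr0 ?addr0 // => x y; rewrite mulrDr.
  by rewrite ffunE hS // add0r; have := psi3S e; rewrite (negPf eS) => /negbFE/eqP ->; rewrite mulr0.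
have shiftK c : cancel (shift c) (shift (- c)).
  by move=> h; apply/ffunP => e; rewrite !ffunE mulNr addrK.
(* On [S] the values of [psi3] are 1 and -1, so different shifts differ at every edge of [S] and
   cannot vanish together. *)
have disj (h : {ffun E -> 'Z_3}) c c' : h \in flows_in s t 'Z_3 S -> c != c' ->
    Z (shift c h) :&: Z (shift c' h) = set0.
  move=> hH cc'; apply/setP => e; rewrite in_setI in_set0; apply/negP => /andP[ec ec'].
  have := subsetP (ZS _ (shiftH c h hH)) e ec; rewrite -psiS => psi0.
  move: ec ec'; rewrite !inE !ffunE !addrA => /eqP ec; rewrite -ec => /eqP /addrI.
  have [|] : psi e = 1 \/ psi e = -1 by have := psi1 e; move: psi0; clear; lia.
    by rewrite /psi3 => ->; rewrite !mulr1 => /eqP; rewrite eq_sym (negPf cc').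
  by rewrite /psi3 => ->; rewrite !mulrN1 => /oppr_inj /eqP; rewrite eq_sym (negPf cc').
have shift0 h : shift 0 h = h by apply/ffunP => e; rewrite ffunE mul0r addr0.
(* Three disjoint zero sets lie in [S], so one of them has at most a third of its edges. *)
have HG : flows_in s t 'Z_3 S \subset G :|: (shift 1 @: G :|: shift (-1) @: G).
  apply/subsetP => h hH; rewrite !in_setU [h \in G]in_set hH /=.
  pose Zp := Z (shift 1 h); pose Zm := Z (shift (-1) h).
  have [//|n0] := leqP (3 * #|Z h|) #|S|; rewrite /=.
  have [n1|n1] := leqP (3 * #|Zp|) #|S|.
    apply/orP; right; rewrite -{1}(shiftK 1 h); apply: imset_f.
    by rewrite in_set shiftH.
  have [n2|n2] := leqP (3 * #|Zm|) #|S|.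
    apply/orP; left; rewrite -{1}(shiftK (-1) h) opprK; apply: imset_f.
    by rewrite in_set shiftH.
  have d1 : Z h :&: Zp = set0 by rewrite -{1}(shift0 h) disj.
  have d2 : (Z h :|: Zp) :&: Zm = set0.
    by rewrite setIUl -{1}(shift0 h) !disj // setU0.
  have := cardsUI (Z h) Zp; have := cardsUI (Z h :|: Zp) Zm.
  have : (#|Z h :|: Zp :|: Zm| <= #|S|)%N.
    by apply: subset_leq_card; rewrite !subUset !ZS // shiftH.
  rewrite d1 d2 cards0 => h1 h2 h3; exfalso; move: h1 h2 h3 n0 n1 n2; clear; lia.
have H3G : (#|flows_in s t 'Z_3 S| <= 3 * #|G|)%N.
  apply: leq_trans (subset_leq_card HG) _.
  apply: leq_trans (leq_card_setU _ _) _; rewrite mulSn leq_add2l.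
  apply: leq_trans (leq_card_setU _ _) _.
  by apply: leq_trans (leq_add (leq_imset_card _ _) (leq_imset_card _ _)) _; rewrite mul2n addnn.
have cH := card_flows_in s t 'Z_3 S v0; rewrite card_ord /= in cH.
have V0 : (0 < #|V|)%N by apply/card_gt0P; exists v0.
(* The factor 3 from [H3G] turns the exponent [#|V| - 1] into [#|V|]. *)
have c3G : (3 ^ #|S| <= #|G| * 3 ^ #|V|)%N.
  apply: leq_trans cH _; rewrite -[X in (_ <= _ * 3 ^ X)%N](subnK V0) expnD mulnC.
  by rewrite mulnA (mulnC #|G|) mulnC -mulnA leq_mul2l; apply/orP; right; rewrite mulnC.
exists #|G|, #|S|; split=> //.
- exact: max_card.
- by rewrite lt0n; apply: contraTneq c3G => ->; rewrite mul0n -ltnNge expn_gt0.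
pose K (h : {ffun E -> 'Z_3}) := flows_in s t 'Z_2 (~: Z h).
have cK h : h \in G -> (2 ^ (#|E| - #|S| %/ 3) <= 2 ^ (#|V| - 1) * #|K h|)%N.
  rewrite in_set => /andP[_ hZ]; have := card_flows_in s t 'Z_2 (~: Z h) v0; rewrite card_ord /=.
  apply: leq_trans; rewrite leq_exp2l // -(cardsC (Z h)).
  by rewrite leq_subLR leq_add2r leq_divRL // mulnC.
apply: (@leq_trans (\sum_(h in G) 2 ^ (#|V| - 1) * #|K h|)%N).
  by rewrite -sum_nat_const; apply: leq_sum => h /cK.
rewrite -big_distrr /= leq_mul2l; apply/orP; right; rewrite -card_pairs.
(* Where the Z_3 part vanishes, the edge lies in [S] and [p.2] is 0, so the Z_2 part is 1. *)
pose F (p : {ffun E -> 'Z_3} * {ffun E -> 'Z_2}) : {ffun E -> 'Z_6} :=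
  [ffun e => emb3 (phi3 e + p.1 e) + emb2 ((e \in S)%:R + p.2 e)].
have Finj : injective F.
  move=> [h z] [h' z'] /ffunP eq; congr (_, _); apply/ffunP => e;
  by have := eq e; rewrite !ffunE /= => /emb_inj [/addrI ? /addrI ?].
rewrite -(card_imset _ Finj); apply/subset_leq_card/subsetP => _ /imsetP [[h z] + ->].
rewrite inE /= => /andP[]; rewrite in_set => /andP[hH _] /flows_inP [zb zZ].
have [hb hS] := flows_inP _ _ _ _ hH.
rewrite inE; apply/andP; split; [apply/forallP => v | apply/forallP => e].
  have -> : bnd s t (F (h, z)) v =
      bnd s t (fun e => (emb3 \o (fun e => phi3 e + h e)) e + (emb2 \o (fun e => (e \in S)%:R + z e)) e) v.
    by apply: eq_bnd => e; rewrite ffunE.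
  rewrite bndD (bnd_morph _ _ _ (f := emb3)) ?(bnd_morph _ _ _ (f := emb2)) ?bndD ?phib ?hb ?evS ?zb ?addr0.
  - by apply/eqP/val_inj.
  - by apply/val_inj.
  - exact: emb2D.
  - by apply/val_inj.
  - exact: emb3D.
rewrite ffunE /=; apply/negP => /eqP /emb_eq0 [e3 e2].
have eZ : e \in Z h by rewrite inE e3.
have eS : e \in S by apply: (subsetP (ZS h hH)).
by move: e2; rewrite eS zZ ?addr0 // inE eZ.
Qed.

End SixFlows.

(** * Arithmetic of the two bounds *)

Lemma six_flows_arith n m k g N : (0 < n)%N -> (3 * n <= 2 * m)%N -> (k <= m)%N -> (0 < g)%N ->
  (3 ^ k <= g * 3 ^ n)%N -> (g * 2 ^ (m - k %/ 3) <= 2 ^ (n - 1) * N)%N ->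
  (2 ^ m <= N ^ 3 * 2 ^ n)%N.
Proof.
move=> n0 nm km g0 gk gN.
(* Truncated subtraction covers [k <= n] through [0 < g]; otherwise a power of 3 is weakened to one
   of 2. *)
have gk2 : (2 ^ (k - n) <= g)%N.
  have [kn|nk] := leqP k n; first by have -> : (k - n)%N = 0%N by lia.
  apply: (@leq_trans (3 ^ (k - n))); first by rewrite leq_exp2r // subn_gt0.
  by move: gk; rewrite -{1}(subnK (ltnW nk)) expnD leq_pmul2r // expn_gt0.
have : (2 ^ (k - n + (m - k %/ 3)) <= 2 ^ (n - 1) * N)%N.
  by apply: leq_trans gN; rewrite expnD leq_mul2r gk2 orbT.
(* Cubing clears the thirds from the exponents; [3 * n <= 2 * m] then settles their comparison. *)
rewrite -(leq_exp2r _ _ (isT : 0 < 3)%N) expnMn -!expnM => cube.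
rewrite -(leq_pmul2l (_ : 0 < 2 ^ ((n - 1) * 3)))%N ?expn_gt0 //.
rewrite mulnA; apply: (@leq_trans (2 ^ ((k - n + (m - k %/ 3)) * 3) * 2 ^ n)%N).
  by rewrite -!expnD leq_exp2l //; have := leq_trunc_div k 3; clear -n0 nm km; lia.
by rewrite leq_mul2r cube orbT.
Qed.

(** After cubing, the exponent [3 * (m - z)] is at least [2 * m], hence at least [4 * n], which
    exceeds [3 * (n - 1) + n]. *)
Lemma Klein_flows_arith n m z N : (0 < n)%N -> (2 * n <= m)%N -> (3 * z <= m)%N ->
  (2 ^ (m - z) <= 2 ^ (n - 1) * N)%N -> (2 ^ n <= N ^ 3)%N.
Proof.
move=> n0 nm zm; rewrite -(leq_exp2r _ _ (isT : 0 < 3)%N) expnMn -!expnM => cube.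
rewrite -(leq_pmul2l (_ : 0 < 2 ^ ((n - 1) * 3)))%N ?expn_gt0 //.
by apply: leq_trans cube; rewrite -expnD leq_exp2l //; clear -n0 nm zm; lia.
Qed.

Lemma powR2_third_le (R : realType) (x : R) (N : nat) :
  powR 2 x <= N%:R ^+ 3 -> powR 2 (x / 3) <= N%:R.
Proof.
move=> H; rewrite -(ler_pXn2r (_ : 0 < 3)%N) ?nnegrE ?powR_ge0 ?ler0n //.
by rewrite -powR_mulrn ?powR_ge0 // -powRrM divfK ?pnatr_eq0.
Qed.

(** * Oriented graphs and the final bounds *)

Section OrientedGraph.
Variable G : ograph.
Let s := @src G.
Let t := @tgt G.

(** Deleting a cut of fewer than [k] edges would leave [Y] closed under adjacency, hence equal to
    the whole vertex set. *)
Lemma edge_connected_cut k (Y : {set vertex G}) : edge_connected G k ->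
  Y != set0 -> Y != setT -> (k <= #|cut s t Y|)%N.
Proof.
case=> _ con Y0 YT; rewrite leqNgt; apply/negP => /con cY.
have [x xY] := set0Pn _ Y0.
case/negP: YT; rewrite eqEsubset subsetT; apply/subsetP => y _.
have cl : closed (adj_del (cut s t Y)) (mem Y).
  move=> a b /existsP [e /andP[]]; rewrite inE negbK => /eqP eY.
  by case/orP=> /andP[/eqP <- /eqP <-].
by have /= <- := closed_connect cl (cY x y).
Qed.

(** Every single vertex has a cut of at least [k] edges, as there are at least two vertices. *)
Lemma edge_connected_degree k : edge_connected G k ->
  (k * #|vertex G| <= 2 * #|edge G|)%N.
Proof.
move=> con; have := sum_card_cut s t [set: edge G] [set: vertex G]; rewrite cardsT.
apply: leq_trans; rewrite mulnC -cardsT -sum_nat_const; apply: leq_sum => v _.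
rewrite setTI; apply: edge_connected_cut => //; first by apply/set0Pn; exists v; rewrite inE.
by apply/negP => /eqP vT; case: con; rewrite -cardsT -vT cards1.
Qed.

Lemma nz_flowsE (A : finZmodType) : nz_flows G A = nz_flow_set s t A.
Proof.
apply/setP => phi; rewrite !inE; congr (_ && _); apply: eq_forallb => v.
rewrite /bnd subr_eq0; congr (_ == _); apply: eq_bigl => e; by rewrite inE.
Qed.

End OrientedGraph.

Theorem theorem1p6 (R : realType) (G : ograph) (n m : nat)
    (hn : #|vertex G| = n) (hm : #|edge G| = m) :
  (edge_connected G 3 ->
     (powR 2 ((m%:R - n%:R) / 3) <= #|nz_flows G 'Z_6|%:R :> R)%R)
  /\
  (edge_connected G 4 ->
     (powR 2 (n%:R / 3) <= #|nz_flows G ('Z_2 * 'Z_2)%type|%:R :> R)%R).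
Proof.
split=> con; apply: powR2_third_le; rewrite nz_flowsE.
  have V0 : (0 < #|vertex G|)%N by case: con => /ltnW.
  have [v0 _] := card_gt0P V0.
  have cut3 Y := @edge_connected_cut G 3 Y con.
  have [g [k [kE g0 gk gN]]] := card_six_flows v0 cut3.
  have := six_flows_arith V0 (edge_connected_degree con) kE g0 gk gN.
  rewrite hn hm -(ler_nat R) natrM !natrX => H.
  have p2 (i : nat) : powR (2 : R) i%:R = 2 ^+ i by rewrite powR_mulrn.
  (* The factor [2 ^+ n] moves the real difference [m - n] back to natural exponents. *)
  rewrite -(ler_pM2r (_ : 0 < 2 ^+ n)) ?exprn_gt0 //; apply: le_trans H.
  by rewrite -!p2 -powRD ?pnatr_eq0 ?implybT ?subrK.
have V0 : (0 < #|vertex G|)%N by case: con => /ltnW.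
have [v0 _] := card_gt0P V0.
have two : two_spanning (@src G) (@tgt G) [set: edge G] [set: vertex G].
  apply: two_spanning_cut4; first by apply/subsetP => e _; rewrite !inE.
    by apply/set0Pn; exists v0.
  by move=> Y _ Y0 YT; rewrite setTI; apply: edge_connected_cut.
have /card_gt0P [phi phiK] := Klein_flow two.
have [z [zE zN]] := card_Klein_flows v0 phiK.
have deg : (2 * #|vertex G| <= #|edge G|)%N by have := edge_connected_degree con; clear; lia.
have := Klein_flows_arith V0 deg zE zN.
by rewrite hn -(ler_nat R) !natrX powR_mulrn.
Qed.
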